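(* The Segre coefficient variety $\mathrm{Coeff}(\mathrm{Seg}_{2,\ell})$ is isomorphic to the GIT quotient $(\mathbb{P}^1)^{2\ell}/\!/\mathrm{SL}_2$ (with respect to the linearization $(1,\dots,1)$).
   Context: Everything is over $\mathbb{C}$. Let $k,\ell$ be positive integers and $n=k\ell$. For a $k\times n$ matrix $A$ with columns $A_1,\dots,A_n\in\mathbb{C}^k$ and an $\ell\times n$ matrix $B$ with columns $B_1,\dots,B_n\in\mathbb{C}^\ell$, the Segre determinant $\mathrm{Seg}_{k,\ell}(A,B)$ is the determinant of the $k\ell\times k\ell$ matrix whose $i$-th column is $A_i\otimes B_i\in\mathbb{C}^k\otimes\mathbb{C}^\ell$. It can be written as a polynomial of bi-degree $(\ell,k)$ in the maximal minors of $A$ and the maximal minors of $B$. Let $\mathrm{Gr}(k,k\ell)^\circ\subset\mathrm{Gr}(k,k\ell)$ be the Zariski open subset of points all of whose Plücker coordinates are non-zero (a point is represented as the row span of a $k\times k\ell$ matrix $A$, and its Plücker coordinates are the maximal minors of $A$). Consider the map $$\pi:\mathrm{Gr}(k,k\ell)^\circ\to\mathbb{P}H^0(\mathrm{Gr}(\ell,k\ell),\mathcal{O}_{\mathrm{Gr}(\ell,k\ell)}(k)),\qquad A\mapsto \mathrm{Seg}_{k,\ell}(A,B),$$ where $\mathrm{Seg}_{k,\ell}(A,B)$ is viewed as a polynomial of degree $k$ in the maximal minors of $B$, i.e. in the Plücker coordinates on $\mathrm{Gr}(\ell,k\ell)$. The Segre coefficient variety $\mathrm{Coeff}(\mathrm{Seg}_{k,\ell})$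 is the Zariski closure of the image of $\pi$. The GIT quotient $(\mathbb{P}^1)^{2\ell}/\!/\mathrm{SL}_2$ is $\mathrm{Proj}\,R$, where $R$ is the graded ring of $\mathrm{SL}_2$-invariants of $2\ell$ ordered points in $\mathbb{P}^1$ with respect to the linearization $1^{2\ell}=(1,\dots,1)$, i.e. $R=\bigoplus_{d\ge0}H^0\big((\mathbb{P}^1)^{2\ell},\mathcal{O}(d,\dots,d)\big)^{\mathrm{SL}_2}$ for the diagonal $\mathrm{SL}_2$-action. *)

(* Defs.v *)
From HB Require Import structures.
From mathcomp Require Import all_boot all_order all_algebra.
From mathcomp Require Import boolp classical_sets.
From mathcomp Require Import mpoly mxtens.

Set Implicit Arguments.
Unset Strict Implicit.
Unset Printing Implicit Defensive.

Import GRing.Theory.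
Local Open Scope ring_scope.
Local Open Scope classical_set_scope.

(* Varieties over an algebraically closed field C are treated classically, as
   spaces with functions: the closed points, the Zariski topology, and for each
   open U the C-valued regular functions on U.  [regular X U phi] only depends
   on the values of phi on U. *)
Record space_with_functions (C : Type) := SpaceWithFunctions {
  point :> Type;
  zclosed : set point -> Prop;
  regular : set point -> (point -> C) -> Prop }.

Definition zopen C (X : space_with_functions C) (U : set X) : Prop :=
  zclosed (~` U).

Definition zclosure C (X : space_with_functions C) (A : set X) : set X :=
  [set x | forall Z : set X, zclosed Z -> A `<=` Z -> Z x].

Definition isomorphic C (X Y : space_with_functions C) : Prop :=
  exists F : X -> Y,
    [/\ bijective F,
        forall Z : set Y, zclosed Z <-> zclosed (F @^-1` Z)
      & forall (U : set Y) (phi : Y -> C), zopen U ->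
          (regular U phi <-> regular (F @^-1` U) (phi \o F))].

(* Common to closed subvarieties of a projective space and to Proj: a set T of
   points, a graded ring of "forms" with pieces gr d, and the relation
   [van p f]: the form f vanishes at p.  Closed sets are the zero loci of sets
   of forms; regular functions are locally quotients f / g of forms of the same
   degree, the quotient having value c at p when f - c g vanishes at p. *)
Section FormSpace.
Variables (C : closedFieldType) (S : comAlgType C) (gr : nat -> set S).
Variables (T : Type) (van : T -> set S).

Definition form_zclosed (Z : set T) : Prop :=
  exists2 E : set S, (forall f, E f -> exists d, gr d f)
                   & Z = [set p | E `<=` van p].

Definition form_regular (U : set T) (phi : T -> C) : Prop :=
  forall p, U p ->
  exists W : set T, [/\ form_zclosed (~` W), W p, W `<=` U &
    exists d f g, [/\ gr d f, gr d g &
      forall q, W q -> ~ van q g /\ van q (f - phi q *: g)]].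

Definition form_space : space_with_functions C :=
  SpaceWithFunctions form_zclosed form_regular.

End FormSpace.

(* Proj of the graded ring R = (+)_d gr d, given inside an ambient ring S. *)
Section Proj.
Variables (C : closedFieldType) (S : comAlgType C) (gr : nat -> set S).

Definition graded_sum : set S :=
  [set f | exists n (h : nat -> S),
    (forall d, gr d (h d)) /\ f = \sum_(d < n) h d].

(* Homogeneous primes of R not containing the irrelevant ideal. *)
Record homogeneous_prime (P : set S) : Prop := HomogeneousPrime {
  hprime_sub : P `<=` graded_sum;
  hprime0 : P 0;
  hprimeD : forall f g, P f -> P g -> P (f + g);
  hprimeM : forall f g, graded_sum f -> P g -> P (f * g);
  hprime_homog : forall n (h : nat -> S), (forall d, gr d (h d)) ->
    P (\sum_(d < n) h d) -> forall d, (d < n)%N -> P (h d);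
  hprime_proper : ~ P 1;
  hprime_prime : forall f g, graded_sum f -> graded_sum g ->
    P (f * g) -> P f \/ P g;
  hprime_relevant : exists d f, [/\ (0 < d)%N, gr d f & ~ P f] }.

Definition closed_point (P : set S) : Prop :=
  homogeneous_prime P /\
  (forall Q, homogeneous_prime Q -> P `<=` Q -> Q `<=` P).

Definition Proj : space_with_functions C :=
  form_space gr (fun p : {P : set S | closed_point P} => sval p).

End Proj.

Section ProjectiveSpace.
Variables (C : closedFieldType) (W : vectType C) (V : {vspace W}).

(* Points of P(V) are the lines in V; forms are homogeneous polynomials in the
   coordinates with respect to a basis of V. *)
Definition proj_point : Type :=
  {L : {vspace W} | (L <= V)%VS && (\dim L == 1%N)}.

Definition proj_form (d : nat) : set {mpoly C[\dim V]} :=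
  [set f | f \is d.-homog].

Definition proj_van (L : proj_point) : set {mpoly C[\dim V]} :=
  [set f | forall v, v \in sval L ->
             f.@[fun i => coord (vbasis V) i v] = 0].

Definition proj_space : space_with_functions C :=
  form_space proj_form proj_van.

Definition proj_subvariety (X : set proj_point) : space_with_functions C :=
  form_space proj_form (fun L : {L : proj_point | X L} => proj_van (sval L)).

End ProjectiveSpace.

Definition plucker_index (k n : nat) : Type :=
  {f : {ffun 'I_k -> 'I_n} | [forall i : 'I_k, forall j : 'I_k, (i < j)%N ==> (f i < f j)%N]}.
HB.instance Definition _ k n := Finite.on (plucker_index k n).

Definition max_minor (A : comNzRingType) k n (M : 'M[A]_(k, n))
    (f : plucker_index k n) : A :=
  \det (colsub (val f) M).

(* The column of index c is A_c (x) B_c. *)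
Definition Seg (S : comNzRingType) k l (A : 'M[S]_(k, k * l))
    (B : 'M[S]_(l, k * l)) : S :=
  \det (\matrix_(r < k * l, c < k * l) tensmx (col c A) (col c B) r ord0).

Section SegreCoefficients.
Variables (C : closedFieldType) (k l : nat).

Definition generic_mx : 'M[{mpoly C[l * (k * l)]}]_(l, k * l) :=
  \matrix_(i, j) 'X_(mxvec_index i j).

(* Polynomials of degree at most k l in the entries of an l x kl matrix, which
   suffices for products of k maximal minors, as vectors of coefficients. *)
Definition coef_space : vectType C :=
  {ffun 'X_{1..(l * (k * l)) < (k * l).+1} -> C^o}.

Definition coefs (F : {mpoly C[l * (k * l)]}) : coef_space :=
  [ffun m : 'X_{1..(l * (k * l)) < (k * l).+1} => F@_m].

(* H^0(Gr(l, kl), O(k)): polynomials of degree k in the Pluecker coordinates,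
   the latter being the maximal minors of the generic l x kl matrix. *)
Definition gr_sections : {vspace coef_space} :=
  <<[seq coefs (\prod_(i < k) max_minor generic_mx (s i))
       | s : {ffun 'I_k -> plucker_index l (k * l)}]>>%VS.

Definition segre_image : set (proj_point gr_sections) :=
  [set L | exists2 A : 'M[C]_(k, k * l),
     (forall f : plucker_index k (k * l), max_minor A f != 0)
   & sval L = <[coefs (Seg (map_mx (fun a => a%:MP) A) generic_mx)]>%VS].

Definition Coeff_Seg : space_with_functions C :=
  proj_subvariety (@zclosure _ (proj_space gr_sections) segre_image).

End SegreCoefficients.

Section GITQuotient.
Variables (C : closedFieldType) (n : nat).

(* SL_2-invariants of H^0((P^1)^n, O(d, ..., d)): polynomials in the entries of
   a 2 x n matrix Z whose columns are homogeneous coordinates of the n points,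
   homogeneous of degree d in each column. *)
Definition SL2_invariants (d : nat) : set {mpoly C[2 * n]} :=
  [set f |
    (forall m, m \in msupp f ->
       forall j : 'I_n, (\sum_(i < 2) m (mxvec_index i j))%N = d) /\
    (forall g : 'M[C]_2, \det g = 1 -> forall Z : 'M[C]_(2, n),
       f.@[mxvec (g *m Z) ord0] = f.@[mxvec Z ord0])].

(* (P^1)^n // SL_2 for the linearization (1, ..., 1). *)
Definition GIT_P1 : space_with_functions C := Proj SL2_invariants.

End GITQuotient.

(* Main.v *)
(* Laplace expansion writes Seg(A, B) as a combination of products of two maximal
   minors of B, of degree 1 in each column of A; since Seg(gA, B) is
   det(g)^l Seg(A, B), the coordinates of Seg(A, .) are SL_2-invariant in A.
   Specializing B to the columns e_r of a perfect matching of the columns turns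
   Seg(A, B) into the product of the brackets [x y] over the matching. By the
   first fundamental theorem (through Capelli's identity) the invariants of
   degree d are spanned by products of brackets along d-regular multigraphs, and
   by Kempe's theorem these are spanned by d-fold products of perfect matchings:
   the Pluecker relation makes the graph bipartite for a fixed partition into
   halves, and Hall's theorem splits off a matching. Hence the coordinates of
   Seg(A, .) generate the ring of invariants R, the homogeneous forms vanishing
   on the image are the kernel of C[y] -> R, and the Segre coefficient variety
   is the set of zeros of that kernel. Closed points of Proj R correspond to
   these zeros by a Nullstellensatz, which is elementary as C is uncountable. *)

Require Import Defs.
From HB Require Import structures.
From mathcomp Require Import all_boot all_order all_algebra fingroup perm.
From mathcomp Require Import ring lra zify.
From mathcomp Require Import boolp.
From mathcomp Require classical_sets.
From mathcomp Require Import reals complex.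
From mathcomp Require Import mpoly mxtens.

Set Implicit Arguments.
Unset Strict Implicit.
Unset Printing Implicit Defensive.

Import Order.TTheory GRing.Theory Num.Theory.
Local Open Scope ring_scope.

(** The coordinates of Seg(A, .) are taken in an arbitrary basis of the section space and may be
    linearly dependent; what counts is that the graded map [segre_param] from C[y] to the invariants
    is onto. Both sides of the isomorphism are spaces of forms, so such a surjection and a bijection
    of points respecting vanishing suffice. The condition that no minor of A vanishes is lost in the
    closure: a polynomial killed by the product of all brackets is zero.

    A point c of the cone is encoded by the kernel of H(y) -> H(ct) in C[t], a domain, so that
    primality is immediate. Generation in degree 1 is used a second time there: a relevant prime of
    R pulls back to one that misses some y_k, and a common zero with y_k = 1 is a projective point.

    Characteristic zero enters through Capelli's identity, where one divides by (d_i + 1) d_j, and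
    through the identification of polynomials with functions. Uncountability enters only as
    [infinite_fibre]: every map from C to nat has a fibre with arbitrarily large finite subsets. *)

(** * Polynomials as functions in characteristic zero *)

Section PolynomialFunctions.
Variable C : numFieldType.

Lemma mpoly_alg_ind n (P : {mpoly C[n]} -> Prop) :
    (forall c, P c%:MP) -> (forall i, P 'X_i) ->
    (forall p q, P p -> P q -> P (p + q)) ->
    (forall p q, P p -> P q -> P (p * q)) -> forall p, P p.
Proof.
move=> PC PX PD PM; elim/mpolyind => [|c m p _ _ Pp]; first exact: (PC 0).
apply: PD Pp; rewrite -mul_mpolyC; apply: (PM _ _ (PC c)).
rewrite mpolyXE_id; elim/big_ind: _ => //; first exact: (PC 1).
by move=> i _; elim: (m i) => [|k IHk]; [exact: (PC 1) | rewrite exprS; apply: PM].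
Qed.

(** Chain rule along the polynomial curve [w]; it reduces questions on partial derivatives to
    polynomials in one variable. *)
Lemma deriv_mmap n (w : 'I_n -> {poly C}) (f : {mpoly C[n]}) :
  (mmap polyC w f)^`() = \sum_i (w i)^`() * mmap polyC w f^`M(i).
Proof.
elim/mpoly_alg_ind: f => [c|j|p q IHp IHq|p q IHp IHq].
- by rewrite mmapC derivC big1 // => i _; rewrite mderivC mmap0 mulr0.
- have UU : (U_(j) - U_(j))%MM = 0%MM :> 'X_{1..n}.
    by apply/mnmP => k; rewrite mnmBE subnn mnm0E.
  rewrite mmapX mmap1U (bigD1 j) //= big1 => [|i ij].
    by rewrite mderivX mnm1E eqxx scale1r UU mpolyX0 rmorph1 mulr1 addr0.
  by rewrite mderivX mnm1E eq_sym (negPf ij) scale0r mmap0 mulr0.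
- rewrite mmapD derivD IHp IHq -big_split; apply: eq_bigr => i _ /=.
  by rewrite mderivD mmapD mulrDr.
- rewrite rmorphM /= derivM IHp IHq mulr_suml mulr_sumr -big_split.
  apply: eq_bigr => i _ /=; rewrite mderivM mmapD !rmorphM /=; ring.
Qed.

Lemma horner_mmap n (w : 'I_n -> {poly C}) (f : {mpoly C[n]}) t :
  (mmap polyC w f).[t] = f.@[fun i => (w i).[t]].
Proof.
elim/mpoly_alg_ind: f => [c|j|p q IHp IHq|p q IHp IHq].
- by rewrite mmapC hornerC mevalC.
- by rewrite mmapX mmap1U mevalXU.
- by rewrite mmapD hornerD IHp IHq mevalD.
- by rewrite rmorphM hornerM IHp IHq mevalM.
Qed.

Lemma poly_eq0_horner (p : {poly C}) : (forall t, p.[t] = 0) -> p = 0.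
Proof.
move=> p0; apply/eqP/negP => /negP p_neq0.
(* The integers below [size p] are distinct in characteristic zero: one root too many. *)
have := max_poly_roots p_neq0 (rs := [seq i%:R | i <- iota 0 (size p)]).
rewrite size_map size_iota ltnn => H; suff: false by []; apply: H.
  by apply/allP => x _; apply/eqP.
by rewrite map_inj_uniq ?iota_uniq // => i j /eqP; rewrite eqr_nat => /eqP.
Qed.

(** If k_i > 0, the coefficient of the monomial k reappears, multiplied by k_i, in the i-th
    derivative; k_i is invertible in characteristic zero. *)
Lemma mderiv_eq0_const n (f : {mpoly C[n]}) :
  (forall i, f^`M(i) = 0) -> f = (f@_0%MM)%:MP.
Proof.
move=> df0.
have coef0 k : k != 0%MM -> f@_k = 0.
  move=> k0; have [i ki] : exists i, k i != 0%N.
    apply/existsP; apply: contraNT k0; rewrite negb_exists => /forallP H.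
    by apply/eqP/mnmP => i; rewrite mnm0E; apply/eqP; rewrite -[_ == _]negbK.
  have := congr1 (mcoeff (k - U_(i))) (df0 i).
  rewrite mcoeff_mderiv mcoeff0 submK ?lep1mP // => /eqP.
  by rewrite -mulr_natr mulf_eq0 pnatr_eq0 orbF => /eqP.
apply/mpolyP => k; rewrite mcoeffC; have [->|k0] := eqVneq k 0%MM.
  by rewrite mulr1.
by rewrite mulr0 coef0.
Qed.

(** Restricting [f] to the line through [v] in direction i shows that the partial derivatives also
    vanish as functions. They are smaller, hence zero by induction, so [f] is a constant with value
    0. *)
Lemma mpoly_eq0_meval n (f : {mpoly C[n]}) : (forall v, f.@[v] = 0) -> f = 0.
Proof.
have [N] := ubnP (msize f); elim: N f => // N IHN f; rewrite ltnS => leN f0.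
have [//|f_neq0] := eqVneq f 0.
have N_gt0 : (0 < N)%N.
  by apply: leq_trans leN; rewrite lt0n msize_poly_eq0.
have df0 i : f^`M(i) = 0.
  apply: IHN => [|v].
    rewrite -(prednK N_gt0) ltnS msizeE; apply/bigmax_leqP_seq => m + _.
    rewrite mcoeff_msupp mcoeff_mderiv => H.
    have /msize_mdeg_lt: (m + U_(i))%MM \in msupp f.
      by rewrite mcoeff_msupp; apply: contraNneq H => ->; rewrite mul0rn.
    by rewrite mdegD mdeg1 addn1 => /leq_trans/(_ leN); rewrite ltn_predRL.
  pose w k := (v k)%:P + (k == i)%:R *: 'X.
  have wt0 : mmap polyC w f = 0.
    by apply: poly_eq0_horner => t; rewrite horner_mmap f0.
  have := deriv_mmap w f; rewrite wt0 linear0 (bigD1 i) //= big1 => [|k ki].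
    rewrite /w derivD derivC eqxx scale1r derivX add0r mul1r addr0.
    move/(congr1 (horner^~ 0)); rewrite horner0 horner_mmap => df_v; rewrite [RHS]df_v.
    by apply: meval_eq => k; rewrite /w hornerD hornerZ hornerC hornerX mulr0 addr0.
  by rewrite /w derivD derivC (negPf ki) scale0r linear0 addr0 mul0r.
have fE := mderiv_eq0_const df0.
have := f0 (fun=> 0); rewrite fE mevalC => f00; by rewrite f00 mpolyC0.
Qed.

End PolynomialFunctions.

Lemma big_ord2 (R : Type) (idx : R) (op : Monoid.law idx) (F : 'I_2 -> R) :
  \big[op/idx]_(a < 2) F a = op (F 0) (F 1).
Proof. by rewrite big_ord_recl big_ord1; congr (op (F _) (F _)); apply: val_inj. Qed.

Lemma ord2_eq (a : 'I_2) : (a = 0) \/ (a = 1).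
Proof. by case: a => [[|[|//]] pa]; [left|right]; apply: val_inj. Qed.

(** * The first fundamental theorem for SL_2 *)

Section Brackets.
Variables (C : numFieldType) (n : nat).
Local Notation S := {mpoly C[2 * n]}.

Definition coord_var (a : 'I_2) (j : 'I_n) : S := 'X_(mxvec_index a j).
Definition coord_deriv (a : 'I_2) (j : 'I_n) (f : S) : S :=
  f^`M(mxvec_index a j).

Definition bracket (i j : 'I_n) : S :=
  coord_var 0 i * coord_var 1 j - coord_var 1 i * coord_var 0 j.

Definition bracket_monomial (s : seq ('I_n * 'I_n)) : S :=
  \prod_(e <- s) bracket e.1 e.2.

(** A list of pairs is the edge list of a multigraph on the columns; a loop counts twice at its
    vertex. *)
Definition edge_degree (s : seq ('I_n * 'I_n)) (j : 'I_n) : nat :=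
  (\sum_(e <- s) ((e.1 == j) + (e.2 == j)))%N.

Definition column_degree (m : 'X_{1..(2 * n)}) (j : 'I_n) : nat :=
  (\sum_(a < 2) m (mxvec_index a j))%N.

Definition multihomog (d : 'I_n -> nat) (f : S) : Prop :=
  forall m, f@_m != 0 -> forall j, column_degree m j = d j.

Lemma mxvec_index_eq (a b : 'I_2) (i j : 'I_n) :
  (mxvec_index a i == mxvec_index b j) = (a == b) && (i == j).
Proof.
have [g gK _] := @curry_mxvec_bij 2 n.
apply/eqP/andP => [eq_ab|[/eqP -> /eqP ->] //].
by have := gK (a, i) isT; rewrite /= eq_ab (gK (b, j)) // => -[-> ->].
Qed.

Lemma coord_deriv_var a b i j :
  coord_deriv a i (coord_var b j) = ((a == b) && (i == j))%:R.
Proof.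
rewrite /coord_deriv /coord_var mderivX mnm1E mxvec_index_eq.
rewrite [b == a]eq_sym [j == i]eq_sym.
have [/andP[/eqP -> /eqP ->]|_] := boolP ((a == b) && (i == j)); last first.
  by rewrite scale0r.
rewrite scale1r (_ : (_ - _)%MM = 0%MM) ?mpolyX0 //.
by apply/mnmP => k; rewrite mnmBE subnn mnm0E.
Qed.

Lemma coord_derivM a i f g : coord_deriv a i (f * g) =
  coord_deriv a i f * g + f * coord_deriv a i g.
Proof. exact: mderivM. Qed.

Lemma coord_derivD a i f g :
  coord_deriv a i (f + g) = coord_deriv a i f + coord_deriv a i g.
Proof. exact: mderivD. Qed.

Lemma coord_derivB a i f g :
  coord_deriv a i (f - g) = coord_deriv a i f - coord_deriv a i g.
Proof. exact: mderivB. Qed.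

Lemma coord_derivN a i f : coord_deriv a i (- f) = - coord_deriv a i f.
Proof. exact: mderivN. Qed.

Lemma coord_deriv0 a i : coord_deriv a i 0 = 0.
Proof. exact: mderiv0. Qed.

Lemma coord_deriv_comm a b i j f :
  coord_deriv a i (coord_deriv b j f) = coord_deriv b j (coord_deriv a i f).
Proof. exact: mderiv_comm. Qed.

Lemma column_degreeD m m' j :
  column_degree (m + m') j = (column_degree m j + column_degree m' j)%N.
Proof. by rewrite -big_split; apply: eq_bigr => a _; rewrite /= mnmDE. Qed.

Lemma column_degree1 a i j : column_degree U_(mxvec_index a i) j = (i == j).
Proof.
rewrite /column_degree (bigD1 a) //= big1 => [|b ba].
  by rewrite mnm1E mxvec_index_eq eqxx addn0.
by rewrite mnm1E mxvec_index_eq eq_sym (negPf ba).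
Qed.

Lemma multihomog0 d : multihomog d 0.
Proof. by move=> m; rewrite mcoeff0 eqxx. Qed.

Lemma multihomog1 : multihomog (fun=> 0%N) 1.
Proof.
move=> m; rewrite mcoeff1; have [-> _ j|_] := eqVneq m 0%MM; last by rewrite eqxx.
by rewrite /column_degree big1 // => a _; rewrite mnm0E.
Qed.

Lemma multihomogD d f g : multihomog d f -> multihomog d g -> multihomog d (f + g).
Proof.
move=> df dg m; have [f0|f0 _] := eqVneq f@_m 0; last exact: df.
by rewrite mcoeffD f0 add0r; apply: dg.
Qed.

Lemma multihomogZ d c f : multihomog d f -> multihomog d (c *: f).
Proof. by move=> df m; rewrite mcoeffZ mulf_eq0 negb_or => /andP[_ /df]. Qed.

Lemma multihomogN d f : multihomog d f -> multihomog d (- f).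
Proof. by move=> df m; rewrite mcoeffN oppr_eq0 => /df. Qed.

Lemma multihomog_sum d (I : Type) (r : seq I) (P : pred I) (F : I -> S) :
  (forall i, P i -> multihomog d (F i)) -> multihomog d (\sum_(i <- r | P i) F i).
Proof.
move=> dF; elim/big_rec: _ => [|i f Pi]; first exact: multihomog0.
by apply: multihomogD; apply: dF.
Qed.

Lemma multihomogM d e f g :
  multihomog d f -> multihomog e g -> multihomog (fun j => d j + e j)%N (f * g).
Proof.
move=> df eg m; rewrite -mcoeff_msupp => /msuppM_le /allpairsP[[m1 m2] /= []].
rewrite !mcoeff_msupp => fm1 gm2 -> j.
by rewrite column_degreeD (df _ fm1) (eg _ gm2).
Qed.

Lemma eq_multihomog d e f : d =1 e -> multihomog d f -> multihomog e f.
Proof. by move=> de df m fm j; rewrite -de; apply: df. Qed.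

Lemma multihomog_var a i : multihomog (fun j => nat_of_bool (i == j)) (coord_var a i).
Proof.
move=> m; rewrite mcoeffX; have [<- _ j|_] := eqVneq U_(mxvec_index a i)%MM m; last by rewrite eqxx.
exact: column_degree1.
Qed.

(** The new degree is given by an equation, which avoids truncated subtraction. *)
Lemma multihomog_deriv d e a i f :
    (forall j, e j + (i == j) = d j)%N ->
  multihomog d f -> multihomog e (coord_deriv a i f).
Proof.
move=> de df m; rewrite mcoeff_mderiv => fm j.
have /df/(_ j) : f@_(m + U_(mxvec_index a i)) != 0.
  by apply: contraNneq fm => ->; rewrite mul0rn.
by rewrite column_degreeD column_degree1 -de => /addIn.
Qed.

Lemma coord_deriv_eq0 d a i f :
  multihomog d f -> d i = 0%N -> coord_deriv a i f = 0.
Proof.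
move=> df di; apply/mpolyP => m; rewrite mcoeff_mderiv mcoeff0.
have [->|/df/(_ i)] := eqVneq f@_(m + U_(mxvec_index a i)) 0.
  by rewrite mul0rn.
by rewrite column_degreeD column_degree1 eqxx di addn1.
Qed.

Lemma multihomog_bracket i j :
  multihomog (fun k => (i == k) + (j == k))%N (bracket i j).
Proof.
apply: multihomogD; last apply: multihomogN; apply: multihomogM;
exact: multihomog_var.
Qed.

Lemma multihomog_prod (I : Type) (r : seq I) (d : I -> 'I_n -> nat) F :
    (forall i, multihomog (d i) (F i)) ->
  multihomog (fun j => \sum_(i <- r) d i j)%N (\prod_(i <- r) F i).
Proof.
move=> dF; elim: r => [|i r IHr].
  by rewrite big_nil; apply: (eq_multihomog _ multihomog1) => j; rewrite big_nil.
rewrite big_cons; apply: (eq_multihomog _ (multihomogM (dF i) IHr)) => j.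
by rewrite big_cons.
Qed.

Lemma multihomog_bracket_monomial s :
  multihomog (edge_degree s) (bracket_monomial s).
Proof. by apply: multihomog_prod => e; apply: multihomog_bracket. Qed.

(** Euler's identity in the two variables of one column. *)
Lemma euler_column d j f : multihomog d f ->
  coord_var 0 j * coord_deriv 0 j f + coord_var 1 j * coord_deriv 1 j f =
  (d j)%:R * f.
Proof.
move=> df.
have XdX a m : coord_var a j * ('X_[m])^`M(mxvec_index a j) =
             (m (mxvec_index a j))%:R * 'X_[m] :> S.
  rewrite mderivX; have [->|ma] := eqVneq (m (mxvec_index a j)) 0%N.
    by rewrite scale0r mul0r mulr0.
  rewrite -scalerAr -mpolyXD addmC submK ?lep1mP //.
  by rewrite -mpolyC_nat mul_mpolyC.
have dE a : coord_var a j * coord_deriv a j f =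
    \sum_(m <- msupp f) f@_m *: ((m (mxvec_index a j))%:R * 'X_[m]).
  rewrite /coord_deriv {1}(mpolyE f) linear_sum mulr_sumr.
  by apply: eq_bigr => m _; rewrite linearZ /= -scalerAr XdX.
rewrite !dE -big_split /= [X in _ = _ * X](mpolyE f) mulr_sumr.
rewrite big_seq [RHS]big_seq; apply: eq_bigr => m /=.
rewrite mcoeff_msupp => mf; rewrite -scalerDr -mulrDl -natrD -scalerAr.
by rewrite -(df _ mf) /column_degree big_ord2.
Qed.

(* The action of the elementary matrix E_ab of gl_2. *)
Definition row_deriv (a b : 'I_2) (f : S) : S :=
  \sum_j coord_var a j * coord_deriv b j f.

(** Commutator of E_ab with a multiplication; the next lemma treats a derivative. Together they tell
    how E_ab commutes with Cayley's operators. *)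
Lemma row_deriv_var_mul a b c i g : row_deriv a b (coord_var c i * g) =
  (b == c)%:R * coord_var a i * g + coord_var c i * row_deriv a b g.
Proof.
rewrite /row_deriv mulr_sumr.
under eq_bigr do rewrite coord_derivM coord_deriv_var mulrDr.
rewrite big_split /=; congr (_ + _); last by apply: eq_bigr => j _; ring.
rewrite (bigD1 i) //= eqxx andbT big1 => [|j ji]; first by ring.
by rewrite (negPf ji) andbF mul0r mulr0.
Qed.

Lemma row_deriv_deriv a b c i f : row_deriv a b (coord_deriv c i f) =
  coord_deriv c i (row_deriv a b f) - (c == a)%:R * coord_deriv b i f.
Proof.
rewrite /row_deriv /coord_deriv linear_sum /= -/(coord_deriv _ _ _).
under [in RHS]eq_bigr do
  rewrite -/(coord_deriv c i _) coord_derivM coord_deriv_var.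
rewrite big_split /= [X in _ = X + _ - _](bigD1 i) //= eqxx andbT.
rewrite [X in _ = _ + X + _ - _]big1 => [|j ji]; last first.
  by rewrite [i == j]eq_sym (negPf ji) andbF mul0r.
rewrite addr0 [X in _ = X - _]addrC addrK; apply: eq_bigr => j _.
by congr (_ * _); apply: coord_deriv_comm.
Qed.

Lemma row_derivD a b f g :
  row_deriv a b (f + g) = row_deriv a b f + row_deriv a b g.
Proof.
by rewrite -big_split; apply: eq_bigr => j _; rewrite coord_derivD mulrDr.
Qed.

Lemma row_derivB a b f g :
  row_deriv a b (f - g) = row_deriv a b f - row_deriv a b g.
Proof.
by rewrite -sumrB; apply: eq_bigr => j _; rewrite coord_derivB mulrBr.
Qed.

(* Cayley's operators: the polarization replacing z_j by z_i, and Omega. *)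
Definition polarize (i j : 'I_n) (f : S) : S :=
  coord_var 0 i * coord_deriv 0 j f + coord_var 1 i * coord_deriv 1 j f.

Definition omega (i j : 'I_n) (f : S) : S :=
  coord_deriv 0 i (coord_deriv 1 j f) - coord_deriv 1 i (coord_deriv 0 j f).

(** Polarization acts on columns and E_ab on rows, so the two commute. *)
Lemma row_deriv_polarize a b i j f : row_deriv a b f = 0 ->
  row_deriv a b (polarize i j f) = 0.
Proof.
move=> f0; rewrite /polarize row_derivD !row_deriv_var_mul !row_deriv_deriv f0.
rewrite !coord_deriv0.
have [->|->] := ord2_eq a; have [->|->] := ord2_eq b; rewrite /=; ring.
Qed.

(** Omega is a 2 x 2 determinant of derivatives, so gl_2 acts on it through the trace; for a != b
    the operator E_ab commutes with it. *)
Lemma row_deriv_omega a b i j f : a != b -> row_deriv a b f = 0 ->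
  row_deriv a b (omega i j f) = 0.
Proof.
move=> ab f0; rewrite /omega row_derivB !row_deriv_deriv f0.
have [a_eq|a_eq] := ord2_eq a; have [b_eq|b_eq] := ord2_eq b;
  move: ab; rewrite a_eq b_eq //= => _;
  rewrite ?mul0r ?mul1r ?subr0 ?coord_deriv0 ?sub0r ?coord_derivN ?coord_deriv0.
- rewrite (coord_deriv_comm 1 1 i j); ring.
- rewrite (coord_deriv_comm 0 0 i j); ring.
Qed.

(** Expanding the double polarization gives the Euler operator of column j plus second-order terms.
    Adding the bracket times Omega exchanges the columns in the mixed terms, which turns the
    second-order part into the Euler operators of i and j applied in turn: d_j + d_i d_j in all. *)
Lemma capelli d i j f : i != j -> multihomog d f ->
  ((d i).+1 * d j)%:R * f =
  polarize j i (polarize i j f) + bracket i j * omega i j f.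
Proof.
move=> ij df.
have euler_i a : coord_var 0 i * coord_deriv 0 i (coord_deriv a j f) +
    coord_var 1 i * coord_deriv 1 i (coord_deriv a j f) =
    (d i)%:R * coord_deriv a j f.
  have [dj0|dj_gt0] := posnP (d j).
    by rewrite (coord_deriv_eq0 _ df) // !coord_deriv0 !mulr0 addr0.
  pose e k := (d k - (j == k))%N.
  rewrite (@euler_column e) /e ?[j == i]eq_sym ?(negPf ij) ?subn0 //.
  apply: multihomog_deriv df => k.
  by rewrite subnK //; case: (j =P k) => // <-.
have euler_j := euler_column j df.
have -> : polarize j i (polarize i j f) + bracket i j * omega i j f =
  (coord_var 0 j * coord_deriv 0 j f + coord_var 1 j * coord_deriv 1 j f) +
  (coord_var 0 j * (coord_var 0 i * coord_deriv 0 i (coord_deriv 0 j f) +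
     coord_var 1 i * coord_deriv 1 i (coord_deriv 0 j f)) +
   coord_var 1 j * (coord_var 0 i * coord_deriv 0 i (coord_deriv 1 j f) +
     coord_var 1 i * coord_deriv 1 i (coord_deriv 1 j f))).
  rewrite /polarize /bracket /omega !coord_derivD !coord_derivM !coord_deriv_var.
  rewrite !eqxx /=; ring.
rewrite !euler_i !(mulrCA _ (d i)%:R) -mulrDr euler_j natrM -natr1; ring.
Qed.

End Brackets.

(** * Invariants are combinations of bracket monomials *)

Section FirstFundamentalTheorem.
Variables (C : numFieldType) (n : nat).
Local Notation S := {mpoly C[2 * n]}.

Definition SL2_invariant (f : S) : Prop :=
  forall g : 'M[C]_2, \det g = 1 -> forall Z : 'M[C]_(2, n),
    f.@[mxvec (g *m Z) ord0] = f.@[mxvec Z ord0].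

(** The identity f((1 + t E_ba) Z) = f(Z) is differentiated at t = 0; left multiplication by 1 + t
    E_ba adds t times row a to row b. *)
Lemma row_deriv_SL2_invariant a b f :
  a != b -> SL2_invariant f -> row_deriv a b f = 0.
Proof.
move=> ab f_inv; apply: mpoly_eq0_meval => v.
pose Z : 'M[C]_(2, n) := vec_mx (\row_k v k).
have vZ k : mxvec Z ord0 k = v k by rewrite vec_mxK mxE.
pose Y := mxvec (delta_mx b a *m Z) ord0.
pose w k := (v k)%:P + Y k *: 'X.
have f_const : mmap polyC w f - (f.@[v])%:P = 0.
  apply: poly_eq0_horner => t; rewrite hornerD hornerN hornerC horner_mmap.
  pose g : 'M[C]_2 := 1%:M + t *: delta_mx b a.
  have det_g : \det g = 1.
    rewrite (expand_det_row _ 0) big_ord2 /cofactor !det_mx11 !mxE /=.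
    move: ab; have [->|->] := ord2_eq a; have [->|->] := ord2_eq b => //= _;
    rewrite ?(mulr0, mulr1, addr0, add0r, expr0, expr1, mul0r) //; ring.
  apply/eqP; rewrite subr_eq0; apply/eqP.
  rewrite -(meval_eq f vZ) -(f_inv g det_g); apply: meval_eq => k.
  rewrite mulmxDl mul1mx -scalemxAl linearD linearZ !mxE -/Y vZ.
  by rewrite !hornerE mulrC.
have := congr1 deriv f_const; rewrite derivB derivC subr0 deriv_mmap linear0.
move/(congr1 (horner^~ 0)); rewrite horner0 horner_sum => df0.
rewrite -[RHS]df0 (reindex _ (curry_mxvec_bij _ _)) /= [RHS]
  (eq_bigr (fun p => (p.1 == b)%:R * (Z a p.2 * (coord_deriv p.1 p.2 f).@[v]))).
  rewrite -(pair_bigA _ (fun c j => (c == b)%:R *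
    (Z a j * (coord_deriv c j f).@[v]))) /= (bigD1 b) //= eqxx.
  rewrite [X in _ = _ + X]big1 => [|c /negPf cb]; last first.
    by rewrite big1 // => j _; rewrite cb mul0r.
  rewrite addr0 /row_deriv raddf_sum; apply: eq_bigr => j _ /=.
  by rewrite mevalM mevalXU mul1r -vZ mxvecE.
move=> [c j] _ /=; rewrite hornerM horner_mmap mulrA; congr (_ * _).
  rewrite derivD derivC derivZ derivX add0r alg_polyC hornerC.
  rewrite /Y mxvecE mxE (bigD1 a) //= !mxE eqxx andbT big1 ?addr0 // => e ea.
  by rewrite !mxE (negPf ea) andbF mul0r.
by apply: meval_eq => k; rewrite /w hornerD hornerZ hornerC hornerX mulr0 addr0.
Qed.

Definition bracket_span (f : S) : Prop :=
  exists r : seq (C * seq ('I_n * 'I_n)),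
    f = \sum_(p <- r) p.1 *: bracket_monomial C p.2.

Lemma bracket_span0 : bracket_span 0.
Proof. by exists [::]; rewrite big_nil. Qed.

Lemma bracket_spanD f g : bracket_span f -> bracket_span g -> bracket_span (f + g).
Proof. by move=> [r ->] [s ->]; exists (r ++ s); rewrite big_cat. Qed.

Lemma bracket_spanZ c f : bracket_span f -> bracket_span (c *: f).
Proof.
move=> [r ->]; exists [seq (c * p.1, p.2) | p <- r].
by rewrite big_map scaler_sumr; apply: eq_bigr => p _ /=; rewrite scalerA.
Qed.

Lemma bracket_span_monomial s : bracket_span (bracket_monomial C s).
Proof. by exists [:: (1, s)]; rewrite big_seq1 scale1r. Qed.

Lemma bracket_span_sum (I : Type) (r : seq I) (F : I -> S) :
  (forall i, bracket_span (F i)) -> bracket_span (\sum_(i <- r) F i).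
Proof.
move=> dF; elim/big_rec: _ => [|i f _]; first exact: bracket_span0.
exact: bracket_spanD.
Qed.

Lemma bracket_spanM (i j : 'I_n) f : bracket_span f -> bracket_span (bracket C i j * f).
Proof.
move=> [r ->]; exists [seq (p.1, (i, j) :: p.2) | p <- r].
rewrite big_map mulr_sumr; apply: eq_bigr => p _ /=.
by rewrite /bracket_monomial big_cons scalerAr.
Qed.

Lemma polarize_bracket (i j a b : 'I_n) : polarize i j (bracket C a b) =
  (j == a)%:R * bracket C i b + (j == b)%:R * bracket C a i.
Proof.
rewrite /polarize /bracket !coord_derivB !coord_derivM !coord_deriv_var /=; ring.
Qed.

Lemma polarizeM i j (f g : S) :
  polarize i j (f * g) = polarize i j f * g + f * polarize i j g.
Proof. by rewrite /polarize !coord_derivM; ring. Qed.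

Lemma polarize_is_linear (i j : 'I_n) : linear (@polarize C n i j).
Proof.
move=> c f g; rewrite /polarize /coord_deriv !linearP /= !mulrDr -!scalerAr.
by rewrite scalerDr addrACA.
Qed.

HB.instance Definition _ i j := GRing.isLinear.Build C S S _
  (@polarize C n i j) (polarize_is_linear i j).

(** Polarization is a derivation and sends a bracket to a combination of brackets. *)
Lemma bracket_span_polarize i j f :
  bracket_span f -> bracket_span (polarize i j f).
Proof.
move=> [r ->]; rewrite linear_sum; apply: bracket_span_sum => -[c s] /=.
rewrite linearZ /=; apply: bracket_spanZ; rewrite /bracket_monomial.
elim: s => [|e s IHs].
  rewrite big_nil /polarize !(coord_deriv_eq0 _ (@multihomog1 C n)) // !mulr0 addr0.
  exact: bracket_span0.
rewrite big_cons polarizeM polarize_bracket mulrDl.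
have bs k l (b : bool) : bracket_span
    (b%:R * bracket C k l * \prod_(e <- s) bracket C e.1 e.2).
  rewrite -mpolyC_nat mul_mpolyC -scalerAl; apply: bracket_spanZ.
  exact/bracket_spanM/bracket_span_monomial.
by apply: bracket_spanD (bracket_spanM _ _ IHs); apply: bracket_spanD.
Qed.

Lemma multihomog_polarize d e (i j : 'I_n) (f : S) : (forall k, e k + (j == k) = d k)%N ->
  multihomog d f -> multihomog (fun k => (i == k) + e k)%N (polarize i j f).
Proof.
move=> de df; apply: multihomogD; apply: multihomogM;
  by [apply: multihomog_var | apply: multihomog_deriv df].
Qed.

Lemma multihomog_omega d e (i j : 'I_n) (f : S) :
    (forall k, e k + (i == k) + (j == k) = d k)%N ->
  multihomog d f -> multihomog e (omega i j f).
Proof.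
move=> de df; apply: multihomogD; last apply: multihomogN;
by apply: multihomog_deriv (multihomog_deriv de df).
Qed.

Lemma bracket_span_const c : bracket_span c%:MP.
Proof. by exists [:: (c, [::])]; rewrite big_seq1 /bracket_monomial big_nil alg_mpolyC. Qed.

Lemma sum_indicator (P : pred 'I_n) j :
  (\sum_(k | P k) (j == k) = P j)%N.
Proof.
rewrite big_mkcond (bigD1 j) //= eqxx big1 => [|k /negPf kj].
  by rewrite addn0; case: (P j).
by rewrite eq_sym kj if_same.
Qed.

(* Induction on the total degree and then on the degree outside a fixed column
   j0: polarization moves a column j into j0, Omega lowers the total degree. *)
Lemma bracket_span_sl2_invariant f d :
    multihomog d f -> row_deriv 0 1 f = 0 -> row_deriv 1 0 f = 0 ->
  bracket_span f.
Proof.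
have [n0|n_gt0] := posnP n.
  move=> _ _ _; rewrite (@mderiv_eq0_const _ _ f); first exact: bracket_span_const.
  by move=> k; case/mxvec_indexP: k => a [j ltjn]; exfalso; rewrite n0 in ltjn.
pose j0 : 'I_n := Ordinal n_gt0.
have [N] := ubnP (\sum_j d j)%N; have [Q] := ubnP (\sum_(j | j != j0) d j)%N.
elim: N d f Q => // N IHN d f Q leQ; rewrite ltnS => leN.
elim: Q d f leN leQ => // Q IHQ d f leN; rewrite ltnS => leQ df E01 E10.
have [[j [jj0 dj]]|dj0] := pselect (exists j, j != j0 /\ (0 < d j)%N).
  have c0 : ((d j0).+1 * d j)%:R != 0 :> C by rewrite pnatr_eq0 muln_eq0 -lt0n.
  have -> : f = ((d j0).+1 * d j)%:R^-1 *:
      (polarize j j0 (polarize j0 j f) + bracket C j0 j * omega j0 j f).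
    rewrite -(capelli _ df) 1?eq_sym // -mpolyC_nat mul_mpolyC scalerA.
    by rewrite mulVf ?scale1r.
  apply: bracket_spanZ; apply: bracket_spanD.
    apply: bracket_span_polarize.
    pose e k := (d k - (j == k))%N.
    have de k : (e k + (j == k) = d k)%N.
      by rewrite subnK //; case: eqP => // <-.
    have sum_e P : (\sum_(k | P k) e k + P j = \sum_(k | P k) d k)%N.
      by rewrite -[in LHS](sum_indicator P j) -big_split; apply: eq_bigr.
    apply: (IHQ _ _ _ _ (multihomog_polarize (i := j0) de df)); rewrite ?big_split /=.
    - by rewrite (sum_indicator predT) addnC sum_e.
    - by rewrite sum_indicator eqxx add0n -addn1 -[1%N]/(true : nat) -jj0 sum_e.
    - exact: row_deriv_polarize.
    - exact: row_deriv_polarize.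
  apply: bracket_spanM.
  (* If column [j0] does not occur, Omega kills [f]; otherwise the subtractions defining [e] below
     are exact. *)
  have [d00|d00] := posnP (d j0).
    rewrite /omega (coord_deriv_comm 0 1) (coord_deriv_comm 1 0 j0).
    rewrite !(coord_deriv_eq0 _ df d00) !coord_deriv0 subr0.
    exact: bracket_span0.
  pose e k := (d k - (j0 == k) - (j == k))%N.
  have de k : (e k + (j0 == k) + (j == k) = d k)%N.
    rewrite /e; case: (j0 =P k) => [k0|_]; case: (j =P k) => [kj|_] /=.
    - by rewrite kj k0 eqxx in jj0.
    - rewrite -k0; lia.
    - rewrite -kj; lia.
    - lia.
  apply: (IHN e _ (\sum_(j | j != j0) e j).+1 _ _ (multihomog_omega de df)) => //.
  - rewrite (leq_trans _ leN) // -(eq_bigr _ (fun k _ => de k)) !big_split /=.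
    rewrite !(sum_indicator predT) /=; lia.
  - exact: row_deriv_omega.
  - exact: row_deriv_omega.
(* Only column [j0] is left. There E_01 and E_10 are a variable times a single derivative, so both
   derivatives vanish and [f] is constant. *)
have d0 j : j != j0 -> d j = 0%N.
  by move=> jj0; have [//|dj] := posnP (d j); case: dj0; exists j.
have E_j0 a b : row_deriv a b f = coord_var C a j0 * coord_deriv b j0 f.
  rewrite /row_deriv (bigD1 j0) //= big1 ?addr0 // => j jj0.
  by rewrite (coord_deriv_eq0 _ df) ?mulr0 // d0.
rewrite (@mderiv_eq0_const _ _ f); first exact: bracket_span_const.
move=> k; case/mxvec_indexP: k => a j; rewrite -/(coord_deriv a j f).
have [->|jj0] := eqVneq j j0; last by rewrite (coord_deriv_eq0 _ df) ?d0.
have X0 b : coord_var C b j0 != 0 by rewrite -msupp_eq0 msuppX.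
move/eqP: E01; move/eqP: E10; rewrite !E_j0 !mulf_eq0 !(negPf (X0 _)) /=.
by have [->|->] := ord2_eq a => /eqP ? /eqP.
Qed.

Lemma bracket_span_SL2_invariant f d :
  multihomog d f -> SL2_invariant f -> bracket_span f.
Proof.
by move=> df f_inv; apply: bracket_span_sl2_invariant df _ _;
  apply: row_deriv_SL2_invariant.
Qed.

Lemma multihomog_bracket_span f d : multihomog d f -> bracket_span f ->
  exists2 r : seq (C * seq ('I_n * 'I_n)),
    f = \sum_(p <- r) p.1 *: bracket_monomial C p.2 &
    forall p, p \in r -> edge_degree p.2 =1 d.
Proof.
move=> df [r f_eq]; exists [seq p <- r | [forall j, edge_degree p.2 j == d j]].
  rewrite big_filter; apply/mpolyP => m.
  pose good := [forall j, column_degree m j == d j].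
  rewrite -[LHS](_ : (if good then f@_m else 0) = _); last first.
    case: ifPn => // /forallPn[j mj]; apply/esym/eqP.
    by apply: contraNT mj => /df ->.
  rewrite {1}f_eq [in RHS]big_mkcond /= !raddf_sum /=.
  transitivity (\sum_(p <- r)
      if good then p.1 * (bracket_monomial C p.2)@_m else 0).
    case: good; last by rewrite big1.
    by apply: eq_bigr => p _; rewrite mcoeffZ.
  apply: eq_bigr => p _; rewrite /good.
  have [M0|/multihomog_bracket_monomial pm] :=
    eqVneq (bracket_monomial C p.2)@_m 0.
    by rewrite M0 mulr0 if_same; case: ifP; rewrite ?mcoeffZ ?M0 ?mulr0 ?mcoeff0.
  under eq_forallb => j do rewrite pm.
  by case: ifP; rewrite ?mcoeffZ ?mcoeff0.
by move=> p; rewrite mem_filter => /andP[/forallP H _] j; apply/eqP.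
Qed.

End FirstFundamentalTheorem.

(** * Kempe's theorem *)

Section Hall.
Variables (T U : finType).
Implicit Types (G : T -> {set U}) (A B : {set T}).

(** Induction on [A]. If a proper nonempty subset B is tight, B is matched into its neighbourhood
    and the rest outside it; otherwise every such subset has a surplus neighbour, and one element
    can be matched arbitrarily. [u0] provides values when [A] is empty. *)
Lemma hall_marriage (u0 : U) G A :
    (forall B, B \subset A -> #|B| <= #|\bigcup_(x in B) G x|)%N ->
  exists2 f : T -> U, {in A &, injective f} & {in A, forall x, f x \in G x}.
Proof.
have [N] := ubnP #|A|; elim: N G A => // N IHN G A; rewrite ltnS => leAN hallA.
have [->|/set0Pn[x0 x0A]] := eqVneq A set0.
  by exists (fun=> u0) => x; rewrite inE.
have [[B [BA B0 BnA tightB]]|no_tight] := pselect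
  (exists B, [/\ B \subset A, B != set0, B != A &
     (#|\bigcup_(x in B) G x| <= #|B|)%N]).
  pose N' := \bigcup_(x in B) G x.
  have ltBA : (#|B| < #|A|)%N by apply: proper_card; rewrite properEneq BnA.
  have [||f f_inj fG] := IHN G B.
  - exact: leq_trans ltBA leAN.
  - by move=> D DB; apply: hallA; apply: subset_trans BA.
  have [||g g_inj gG] := IHN (fun x => G x :\: N') (A :\: B).
  - apply: leq_trans leAN; apply: proper_card; rewrite properE subsetDl.
    apply/subsetPn; have /set0Pn[x xB] := B0.
    by exists x; rewrite ?(subsetP BA) // !inE xB.
  - move=> D DAB.
    have DA : D \subset A by apply: subset_trans DAB (subsetDl _ _).
    have DB0 : B :&: D = set0.
      apply/setP => x; rewrite !inE; apply/andP => -[xB /(subsetP DAB)].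
      by rewrite !inE xB.
    (* Hall's condition for the union, from which the tight set [B] is subtracted. *)
    have := hallA (B :|: D); rewrite subUset BA DA => /(_ isT).
    rewrite cardsU DB0 cards0 subn0 bigcup_setU -/N' => H.
    rewrite -(leq_add2l #|B|); apply: leq_trans H _.
    apply: (@leq_trans #|N' :|: \bigcup_(x in D) (G x :\: N')|).
      apply/subset_leq_card/subsetP => y; rewrite !inE.
      have [//|yN] := boolP (y \in N'); case/orP=> [//|/bigcupP[x xD yx]].
      by apply/bigcupP; exists x; rewrite // inE yN.
    apply: leq_trans (leq_of_leqif (leq_card_setU _ _)) _.
    by rewrite leq_add2r.
  exists (fun x => if x \in B then f x else g x) => [x y xA yA|x xA].
    have fgN z w : z \in B -> w \in A -> w \notin B -> f z != g w.
      move=> zB wA wB; apply/eqP => fg.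
      have := gG w; rewrite !inE wA wB => /(_ isT) /andP[/negP[]].
      by rewrite -fg; apply/bigcupP; exists z; rewrite // fG.
    case: ifPn => xB; case: ifPn => yB.
    - exact: f_inj.
    - by move/eqP; rewrite (negPf (fgN _ _ _ _ _)).
    - by move/esym/eqP; rewrite (negPf (fgN _ _ _ _ _)).
    - by apply: g_inj; rewrite inE ?xB ?yB.
  case: ifPn => xB; first exact: fG.
  by have := gG x; rewrite !inE xA xB => /(_ isT) /andP[].
have [u u_x0] : exists u, u \in G x0.
  apply/set0Pn; rewrite -card_gt0; have := hallA [set x0].
  by rewrite sub1set x0A cards1 big_set1 => /(_ isT).
have [||f f_inj fG] := IHN (fun x => G x :\ u) (A :\ x0).
- by apply: leq_trans leAN; rewrite (cardsD1 x0 A) x0A.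
- move=> B BA; have [->|B0] := eqVneq B set0; first by rewrite cards0.
  have BA' : B \subset A by apply: subset_trans BA (subsetDl _ _).
  (* [B] misses [x0], so it is not tight; its surplus neighbour pays for the removal of [u]. *)
  have ltB : (#|B| < #|\bigcup_(x in B) G x|)%N.
    rewrite ltnNge; apply/negP => tight; apply: no_tight; exists B.
    split=> //; apply: contraTneq BA => ->.
    by apply/subsetPn; exists x0; rewrite // !inE eqxx.
  rewrite -ltnS; apply: leq_trans ltB _.
  apply: leq_trans (_ : #|u |: \bigcup_(x in B) (G x :\ u)| <= _)%N.
    apply/subset_leq_card/subsetP => y /bigcupP[x xB yx]; rewrite !inE.
    by case: eqVneq => //= yu; apply/bigcupP; exists x; rewrite // !inE yu.
  by rewrite cardsU1 -add1n leq_add2r leq_b1.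
exists (fun x => if x == x0 then u else f x) => [x y xA yA|x xA].
  have fu z : z \in A -> z != x0 -> f z != u.
    by move=> zA z0; have := fG z; rewrite !inE zA z0 => /(_ isT) /andP[].
  case: (eqVneq x x0) => [->|x0'] /=; case: (eqVneq y x0) => [->|y0] //=.
  - by move/esym/eqP; rewrite (negPf (fu _ yA y0)).
  - by move/eqP; rewrite (negPf (fu _ xA x0')).
  - by apply: f_inj; rewrite !inE ?x0' ?y0.
case: eqVneq => [->//|xx0].
by have := fG x; rewrite !inE xA xx0 => /(_ isT) /andP[].
Qed.

End Hall.

(** * Regular multigraphs as products of perfect matchings *)

Section Kempe.
Variables (C : numFieldType) (n : nat) (X : {set 'I_n}).
Hypothesis X_half : #|X| = #|~: X|.
Local Notation S := {mpoly C[2 * n]}.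
Implicit Types s t : seq ('I_n * 'I_n).

Definition perfect_matching t : Prop := forall j, edge_degree t j = 1%N.

Lemma edge_degree_cons e s j :
  edge_degree (e :: s) j = ((e.1 == j) + (e.2 == j) + edge_degree s j)%N.
Proof. by rewrite /edge_degree big_cons. Qed.

Lemma bracket_monomial_cons e s :
  bracket_monomial C (e :: s) = bracket C e.1 e.2 * bracket_monomial C s.
Proof. by rewrite /bracket_monomial big_cons. Qed.

Lemma bracket_monomial_cat s t :
  bracket_monomial C (s ++ t) = bracket_monomial C s * bracket_monomial C t.
Proof. by rewrite /bracket_monomial big_cat. Qed.

Lemma perm_edge_degree s t : perm_eq s t -> edge_degree s =1 edge_degree t.
Proof. by move=> st j; apply: perm_big. Qed.

Lemma perm_bracket_monomial s t :
  perm_eq s t -> bracket_monomial C s = bracket_monomial C t.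
Proof. exact: perm_big. Qed.

Lemma sum_edge_degree (A : {set 'I_n}) s :
  (\sum_(j in A) edge_degree s j = \sum_(e <- s) ((e.1 \in A) + (e.2 \in A)))%N.
Proof.
rewrite exchange_big; apply: eq_bigr => e _ /=.
by rewrite big_split /= !sum_indicator.
Qed.

Lemma plucker_relation (a b c e : 'I_n) : bracket C a b * bracket C c e =
  bracket C a c * bracket C b e + (-1) *: (bracket C a e * bracket C b c).
Proof. by rewrite scaleN1r /bracket; ring. Qed.

Lemma bracketC (a b : 'I_n) : bracket C a b = - bracket C b a.
Proof. by rewrite /bracket; ring. Qed.

(* Edges that do not cross the partition. *)
Let bad (e : 'I_n * 'I_n) := (e.1 \in X) == (e.2 \in X).

(** The degrees sum to the same number over [X] and over its complement, so as many edges lie inside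
    [X] as outside; one bad edge therefore forces one of each kind. *)
Lemma regular_bad_edges d s : (forall j, edge_degree s j = d) -> has bad s ->
  exists a b c e s', [/\ a \in X, b \in X, c \notin X, e \notin X &
    perm_eq s [:: (a, b), (c, e) & s']].
Proof.
move=> s_reg.
pose inX (e : 'I_n * 'I_n) := (e.1 \in X) && (e.2 \in X).
pose outX (e : 'I_n * 'I_n) := (e.1 \notin X) && (e.2 \notin X).
have eq_sum : (\sum_(e <- s) ((e.1 \in X) + (e.2 \in X)) =
               \sum_(e <- s) ((e.1 \in ~: X) + (e.2 \in ~: X)))%N.
  rewrite -!sum_edge_degree; under eq_bigr do rewrite s_reg.
  by under [in RHS]eq_bigr do rewrite s_reg; rewrite !sum_nat_const X_half.
have eq_count : count inX s = count outX s.
  have : (\sum_(e <- s) ((e.1 \in X) + (e.2 \in X)) + 2 * count outX s =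
      \sum_(e <- s) ((e.1 \in ~: X) + (e.2 \in ~: X)) + 2 * count inX s)%N.
    rewrite -!sum1_count 2![(\sum_(i <- s | _) 1)%N]big_mkcond !big_distrr.
    rewrite -!big_split; apply: eq_bigr => e _ /=; rewrite !inE /inX /outX.
    by case: (e.1 \in X); case: (e.2 \in X).
  lia.
move=> has_bad; have [has_in has_out] : has inX s /\ has outX s.
  have : (0 < count inX s + count outX s)%N.
    rewrite -count_predUI; apply: leq_trans (leq_addr _ _).
    rewrite -has_count; apply: sub_has has_bad => e; rewrite /bad /= /inX /outX.
    by case: (e.1 \in X); case: (e.2 \in X).
  by rewrite !has_count; lia.
have /hasP[[a b] ab_s /andP[/= aX bX]] := has_in.
have /hasP[[c e] ce_s /andP[/= cX eX]] := has_out.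
have s_perm := perm_to_rem ab_s.
have ce_rem : (c, e) \in rem (a, b) s.
  move: ce_s; rewrite (perm_mem s_perm) inE => /orP[/eqP[ca _]|//].
  by rewrite ca aX in cX.
exists a, b, c, e, (rem (c, e) (rem (a, b) s)); split=> //.
by apply: perm_trans s_perm _; rewrite perm_cons perm_to_rem.
Qed.

(** The d.+1 edges at each vertex of B all end among its neighbours, which receive at most d.+1
    each: this is Hall's condition. The resulting injection from [X] is onto the complement by
    cardinality. *)
Lemma bipartite_regular_matching d s :
    (forall j, edge_degree s j = d.+1) ->
    {in s, forall e, (e.1 \in X) && (e.2 \notin X)} ->
  exists t s', perfect_matching t /\ perm_eq s (t ++ s').
Proof.
move=> s_reg s_bip; pose G (x : 'I_n) := [set y | (x, y) \in s].
have [X0|[x0 _]] := set_0Vmem X.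
  exists [::], s; split=> // j; have : j \in X :|: ~: X by rewrite setUCr inE.
  have /eqP: #|~: X| = 0%N by rewrite -X_half X0 cards0.
  by rewrite cards_eq0 => /eqP ->; rewrite X0 setU0 inE.
have [B BX|f f_inj fG] := @hall_marriage _ _ x0 G X.
  rewrite -(leq_pmul2r (ltn0Sn d)) -!sum_nat_const.
  under eq_bigr => x _ do rewrite -(s_reg x).
  under [in leqRHS]eq_bigr => x _ do rewrite -(s_reg x).
  rewrite !sum_edge_degree big_seq [in leqRHS]big_seq; apply: leq_sum => e es.
  have /andP[e1 e2] := s_bip e es.
  have /negPf -> : e.2 \notin B by apply: contra e2; apply: (subsetP BX).
  rewrite addn0; have [e1B|//] := boolP (e.1 \in B).
  rewrite (_ : e.2 \in _) ?leq_addl //; apply/bigcupP; exists e.1 => //.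
  by rewrite inE -surjective_pairing.
pose t := [seq (x, f x) | x <- enum X].
have t_uniq : uniq t.
  by rewrite map_inj_uniq ?enum_uniq // => x y [].
have t_sub : {subset t <= s}.
  by move=> e /mapP[x]; rewrite mem_enum => /fG; rewrite inE => ? ->.
(* [t] has no repetition, so it can be removed from [s] as a multiset although [s] may have multiple
   edges. *)
have /count_subseqP[t' t's tt'] : forall e, (count_mem e t <= count_mem e s)%N.
  move=> e; rewrite count_uniq_mem //; have [/t_sub|//] := boolP (e \in t).
  by rewrite -has_pred1 has_count.
have [s' s_perm] := perm_to_subseq t's.
exists t, s'; split; last first.
  by apply: perm_trans s_perm _; rewrite perm_cat2r perm_sym.
have f_img : f @: X = ~: X.
  apply/eqP; rewrite eqEcard -X_half card_in_imset // leqnn andbT.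
  apply/subsetP => y /imsetP[x /fG]; rewrite inE => xfx ->.
  by rewrite inE; have /andP[] := s_bip _ xfx.
move=> j; rewrite /edge_degree big_map big_enum /= big_split /=.
under eq_bigr do rewrite eq_sym; rewrite sum_indicator.
have [jX|jX] := boolP (j \in X).
  rewrite big1 // => x xX; apply/eqP; rewrite eqb0; apply: contraTneq jX => <-.
  by rewrite -in_setC -f_img imset_f.
have /imsetP[x xX jfx] : j \in f @: X by rewrite f_img inE.
rewrite (bigD1 x) //= -jfx eqxx big1 // => y /andP[yX yx].
apply/eqP; rewrite eqb0 jfx; apply: contra yx => /eqP fyx.
by apply/eqP/f_inj.
Qed.

(** [Q d f] abstracts the property of being a combination of d-fold products of perfect matchings;
    it is later instantiated with the images of the forms of degree d. *)
Variable Q : nat -> S -> Prop.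
Hypothesis Q1 : Q 0 1.
Hypothesis QD : forall d f g, Q d f -> Q d g -> Q d (f + g).
Hypothesis QZ : forall d c f, Q d f -> Q d (c *: f).
Hypothesis QM : forall d t f, perfect_matching t -> Q d f ->
  Q d.+1 (bracket_monomial C t * f).

(* Pluecker relations replace an edge inside X and one outside X by two edges
   across, so that s may be assumed bipartite. *)
Theorem kempe d s : (forall j, edge_degree s j = d) -> Q d (bracket_monomial C s).
Proof.
elim: d s => [|d IHd] s.
  case: s => [_|e s /(_ e.1)]; last by rewrite edge_degree_cons eqxx.
  by rewrite /bracket_monomial big_nil.
have [N] := ubnP (count bad s); elim: N s => // N IHN s; rewrite ltnS => leN.
move=> s_reg; have [has_bad|no_bad] := boolP (has bad s).
  have [a [b [c [e [s' [aX bX cX eX s_perm]]]]]] := regular_bad_edges s_reg has_bad.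
  have s'_bad : (count bad s' < N)%N.
    apply: leq_trans leN; rewrite (seq.permP s_perm) /= /bad /= aX bX.
    by rewrite (negPf cX) (negPf eX) !eqxx /=; lia.
  have s'_reg j : ((a == j) + (b == j) + (c == j) + (e == j) +
      edge_degree s' j = d.+1)%N.
    by rewrite -(s_reg j) (perm_edge_degree s_perm) !edge_degree_cons /=; ring.
  rewrite (perm_bracket_monomial s_perm) !bracket_monomial_cons /= mulrA.
  rewrite plucker_relation mulrDl -scalerAl; apply: QD; last apply: QZ.
    rewrite -mulrA -!(bracket_monomial_cons (_, _)); apply: IHN => [|j].
      by rewrite /= /bad /= aX bX (negPf cX) (negPf eX).
    by rewrite !edge_degree_cons -(s'_reg j) /=; ring.
  rewrite -mulrA -!(bracket_monomial_cons (_, _)); apply: IHN => [|j].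
    by rewrite /= /bad /= aX bX (negPf cX) (negPf eX).
  by rewrite !edge_degree_cons -(s'_reg j) /=; ring.
(* All edges now cross; they are directed out of [X], and the signs of the reversed brackets are
   collected in a scalar. *)
pose orient (e : 'I_n * 'I_n) := if e.1 \in X then e else (e.2, e.1).
have [c ->] : exists c, bracket_monomial C s =
    c *: bracket_monomial C [seq orient e | e <- s].
  elim: (s) => [|e s' [c IHs]]; first by exists 1; rewrite scale1r.
  rewrite /= !bracket_monomial_cons IHs /orient.
  case: ifP => _; first by exists c; rewrite scalerAr.
  by exists (- c); rewrite bracketC scaleNr mulNr scalerAr.
apply: QZ.
have [t [s' [t_perf s_perm]]] : exists t s', perfect_matching t /\
    perm_eq [seq orient e | e <- s] (t ++ s').
  apply: (@bipartite_regular_matching d) => [j|e /mapP[e' e's ->]].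
    rewrite -(s_reg j) /edge_degree big_map; apply: eq_bigr => e _.
    by rewrite /orient; case: ifP => // _; rewrite addnC.
  have := hasPn no_bad _ e's; rewrite /bad /orient; case: ifPn => eX /=.
    by rewrite eX; case: (_ \in X).
  by rewrite (negPf eX); case: (_ \in X).
rewrite (perm_bracket_monomial s_perm) bracket_monomial_cat.
apply: QM => //; apply: IHd => j; apply/eqP.
rewrite -(eqn_add2l (edge_degree t j)) {2}t_perf add1n -(s_reg j).
have := perm_edge_degree s_perm j; rewrite /edge_degree big_cat /= => <-.
rewrite big_map; apply/eqP/eq_bigr => e _.
by rewrite /orient; case: ifP => // _; rewrite addnC.
Qed.

End Kempe.

(** * The Segre determinant *)

Section Determinants.

(** Rows and columns are reindexed by injections together with an equation m = n because the index
    types of l + l and 2 * l are not convertible. *)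
Lemma det_mxsub_bij (R : comNzRingType) m n (M : 'M[R]_n) (p q : 'I_m -> 'I_n) :
    m = n -> injective p -> injective q ->
  exists b : bool, \det M = (-1) ^+ b * \det (mxsub p q M).
Proof.
move=> mn; case: _ / mn M p q => M p q p_inj q_inj.
have -> : mxsub p q M = perm_mx (perm p_inj) *m (M *m perm_mx (perm q_inj)^-1%g).
  rewrite -row_permE -col_permE; apply/matrixP => i j.
  by rewrite !mxE !permE.
rewrite !det_mulmx !det_perm; exists (perm p_inj (+) perm q_inj).
rewrite odd_permV; case: (odd_perm _); case: (odd_perm _) => /=; ring.
Qed.

Lemma det_mxsub_same (R : comNzRingType) m n (M : 'M[R]_n) (p : 'I_m -> 'I_n) :
  m = n -> injective p -> \det (mxsub p p M) = \det M.
Proof.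
move=> mn; case: _ / mn M p => M p p_inj.
have -> : mxsub p p M = perm_mx (perm p_inj) *m (M *m perm_mx (perm p_inj)^-1%g).
  rewrite -row_permE -col_permE; apply/matrixP => i j.
  by rewrite !mxE !permE.
by rewrite !det_mulmx !det_perm odd_permV; case: (odd_perm _) => /=; ring.
Qed.

(* The lower right block is shifted by 'X, which makes its determinant monic,
   hence cancellable. *)
Lemma det_block_diag (R : comNzRingType) n (a b c d : 'rV[R]_n) :
  \det (block_mx (diag_mx a) (diag_mx b) (diag_mx c) (diag_mx d)) =
  \prod_i (a 0 i * d 0 i - b 0 i * c 0 i).
Proof.
pose P (v : 'rV[R]_n) := map_mx polyC v.
pose e : 'rV[{poly R}]_n := \row_i ((d 0 i)%:P + 'X).
have det_e : \det (block_mx (diag_mx (P a)) (diag_mx (P b)) (diag_mx (P c))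
    (diag_mx e)) = \prod_i (P a 0 i * e 0 i - P b 0 i * P c 0 i).
  have e_monic : \det (diag_mx e) \is monic.
    rewrite det_diag; apply: monic_prod => i _.
    by rewrite mxE addrC -[_%:P]opprK -polyCN monicXsubC.
  apply: (monic_lreg e_monic); rewrite mulrC.
  rewrite [in LHS](_ : \det (diag_mx e) = \det (block_mx (diag_mx e) 0
    (- diag_mx (P c)) 1%:M)); last by rewrite det_lblock det1 mulr1.
  rewrite -det_mulmx mulmx_block !mulmx0 !mulmx1 !add0r.
  rewrite !mulmxN [diag_mx e *m _]diag_mxC subrr det_ublock mulrC; congr (_ * _).
  rewrite !mulmx_diag -linearB /= det_diag.
  by apply: eq_bigr => i _; rewrite !mxE.
have := congr1 (horner_eval 0) det_e; rewrite -det_map_mx map_block_mx !map_diag_mx.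
rewrite rmorph_prod /=.
have evP v : map_mx (horner_eval 0) (P v) = v.
  by apply/rowP => i; rewrite !mxE /horner_eval hornerC.
rewrite !evP (_ : map_mx (horner_eval 0) e = d) => [->|]; last first.
  by apply/rowP => i; rewrite !mxE /horner_eval !hornerE.
apply: eq_bigr => i _; rewrite !mxE /horner_eval.
by rewrite hornerD hornerN !hornerM hornerD !hornerC hornerX addr0.
Qed.

Lemma strict_enum n l (I : {set 'I_n}) : #|I| = l ->
  exists f : plucker_index l n, forall x, x \in I = (x \in codom (val f)).
Proof.
move=> cardI.
pose f := [ffun i : 'I_l => enum_val (cast_ord (esym cardI) i)].
have f_incr : [forall i : 'I_l, forall j : 'I_l, (i < j)%N ==> (f i < f j)%N].
  apply/forallP => i; apply/forallP => j; apply/implyP => ij; rewrite !ffunE.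
  have x0 : 'I_n := f i.
  rewrite !(enum_val_nth x0) /= -!(nth_map x0 0%N val) -?cardE ?cardI //.
  have : sorted ltn (map val (enum I)).
    have -> : enum I = [seq x <- enum 'I_n | x \in I] by rewrite enumT.
    rewrite sorted_map; apply: sorted_filter; first by move=> ? ? ?; apply: ltn_trans.
    by rewrite -sorted_map val_enum_ord iota_ltn_sorted.
  by move/(sorted_ltn_nth ltn_trans); apply; rewrite // inE size_map -cardE cardI.
exists (exist _ f f_incr) => x; apply/idP/codomP => /= [xI|[i ->]].
  exists (cast_ord cardI (enum_rank_in xI x)).
  by rewrite ffunE cast_ordK enum_rankK_in.
by rewrite ffunE enum_valP.
Qed.

Lemma plucker_index_inj l n (f : plucker_index l n) : injective (val f).
Proof.
case: f => f /= /forallP f_incr i j fij; apply/val_inj/eqP.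
have lt_f (x y : 'I_l) : (x < y)%N -> (f x < f y)%N.
  by have /forallP/(_ y)/implyP := f_incr x.
by case: (ltngtP i j) => // /lt_f; rewrite fij ltnn.
Qed.

(** Lists the rows of the tensor product by blocks: those with first factor 0, then those with first
    factor 1. *)
Definition half_row l (i : 'I_(l + l)) : 'I_(2 * l) :=
  match split i with
  | inl r => mxtens_index (0 : 'I_2, r) | inr r => mxtens_index (1 : 'I_2, r) end.

Lemma half_row_inj l : injective (@half_row l).
Proof.
move=> i j; rewrite /half_row; case: (splitP i) => r ir; case: (splitP j) => s js;
move/(can_inj (@mxtens_indexK 2 l)) => // -[rs]; apply: val_inj; rewrite /= ir js;
by rewrite ?rs // (val_inj rs).
Qed.

End Determinants.

(** * Expansion and equivariance of the Segre determinant *)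

Section SegreDeterminant.
Variables (R : comNzRingType).

Definition segre_mx k l (A : 'M[R]_(k, k * l)) (B : 'M[R]_(l, k * l)) :
    'M[R]_(k * l) :=
  \matrix_(r, c) (A (mxtens_unindex r).1 c * B (mxtens_unindex r).2 c).

Lemma segE k l (A : 'M[R]_(k, k * l)) (B : 'M[R]_(l, k * l)) :
  Seg A B = \det (segre_mx A B).
Proof. by congr (\det _); apply/matrixP => r c; rewrite !mxE. Qed.

Definition selector k n (s : {ffun 'I_n -> 'I_k}) : 'M[R]_(k, n) :=
  \matrix_(a, c) (a == s c)%:R.

(** Each column of [A] is expanded in the standard basis; [selector s] has the basis vector e_(s c)
    as column c. *)
Lemma seg_multilinear k l (A : 'M[R]_(k, k * l)) (B : 'M[R]_(l, k * l)) :
  Seg A B = \sum_(s : {ffun 'I_(k * l) -> 'I_k})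
    (\prod_c A (s c) c) * Seg (selector s) B.
Proof.
rewrite segE -det_tr /determinant.
transitivity (\sum_(p : 'S_(k * l)) (-1) ^+ p *
    \sum_(s : {ffun 'I_(k * l) -> 'I_k})
       (\prod_c A (s c) c) * \prod_c segre_mx (selector s) B (p c) c).
  apply: eq_bigr => p _; congr (_ * _).
  transitivity (\prod_c \sum_a A a c * ((a == (mxtens_unindex (p c)).1)%:R *
      B (mxtens_unindex (p c)).2 c)).
    apply: eq_bigr => c _; rewrite !mxE (bigD1 (mxtens_unindex (p c)).1) //=.
    rewrite eqxx mul1r big1 ?addr0 // => a /negPf ->.
    by rewrite mul0r mulr0.
  rewrite bigA_distr_bigA; apply: eq_bigr => s _; rewrite big_split.
  by congr (_ * _); apply: eq_bigr => c _; rewrite !mxE eq_sym.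
under eq_bigr do rewrite mulr_sumr.
rewrite exchange_big; apply: eq_bigr => s _ /=.
rewrite segE -[in RHS]det_tr /determinant mulr_sumr; apply: eq_bigr => p _.
by rewrite mulrCA; congr (_ * (_ * _)); apply: eq_bigr => c _; rewrite [in RHS]mxE.
Qed.

(** A permutation with a nonzero term matches the columns where [s] is 0 with the rows whose first
    tensor index is 0, and there are l of these. *)
Lemma seg_selector_eq0 l (s : {ffun 'I_(2 * l) -> 'I_2}) (B : 'M[R]_(l, 2 * l)) :
  #|[set c | s c == 0]| != l -> Seg (selector s) B = 0.
Proof.
move=> card_s; rewrite segE -det_tr /determinant big1 // => p _.
have [c sc] : exists c, (mxtens_unindex (p c)).1 != s c.
  apply/existsP; apply: contraNT card_s => /existsPn H.
  have -> : [set c | s c == 0] = p @^-1: [set r | (mxtens_unindex r).1 == 0 :> 'I_2].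
    by apply/setP => c; rewrite !inE; have /negPn/eqP -> := H c.
  rewrite card_preimset; last exact: perm_inj.
  rewrite -[X in _ == X]card_ord.
  have inj : injective (fun r : 'I_l => mxtens_index (0 : 'I_2, r)).
    by move=> r r' /(can_inj (@mxtens_indexK 2 l)) [].
  rewrite -(card_imset predT inj); apply/eqP/eq_card => r; rewrite inE.
  apply/eqP/imsetP => [r0|[r' _ ->]]; last by rewrite mxtens_indexK.
  exists (mxtens_unindex r).2 => //.
  by rewrite -r0 -surjective_pairing mxtens_unindexK.
by rewrite (bigD1 c) //= !mxE (negPf sc) !mul0r mulr0.
Qed.

(** Ordering the columns by the value of [s] makes the matrix block diagonal, with complementary
    maximal minors of [B] as blocks. *)
Lemma seg_selector_minors l (s : {ffun 'I_(2 * l) -> 'I_2}) (B : 'M[R]_(l, 2 * l)) :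
  #|[set c | s c == 0]| = l ->
  exists (b : bool) f g,
    Seg (selector s) B = (-1) ^+ b * (max_minor B f * max_minor B g).
Proof.
move=> card_s.
have card_sC : #|~: [set c | s c == 0]| = l.
  by have := cardsC [set c | s c == 0]; rewrite card_ord card_s; lia.
have [f fE] := strict_enum card_s; have [g gE] := strict_enum card_sC.
pose q (i : 'I_(l + l)) : 'I_(2 * l) :=
  match split i with inl r => val f r | inr r => val g r end.
have sf r : s (val f r) = 0.
  by have := fE (val f r); rewrite codom_f inE => /eqP.
have sg r : s (val g r) = 1.
  have := gE (val g r); rewrite codom_f !inE => /negP.
  by have [->|//] := ord2_eq (s (val g r)).
have q_inj : injective q.
  move=> i j; rewrite /q; case: (splitP i) => r ir; case: (splitP j) => t jt qq.
  - by apply: val_inj; rewrite /= ir jt (plucker_index_inj qq).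
  - by have := sf r; rewrite qq sg.
  - by have := sf t; rewrite -qq sg.
  - by apply: val_inj; rewrite /= ir jt (plucker_index_inj qq).
have [|b bE] := det_mxsub_bij (segre_mx (selector s) B) _ (@half_row_inj l) q_inj.
  lia.
exists b, f, g; rewrite segE bE; congr (_ * _).
rewrite (_ : mxsub _ _ _ = block_mx (colsub (val f) B) 0 0 (colsub (val g) B)).
  by rewrite det_ublock.
apply/matrixP => i j; rewrite !mxE /half_row /q.
case: (splitP i) => r ir; rewrite !mxE; case: (splitP j) => t jt;
rewrite ?mxE !mxtens_indexK /= ?sf ?sg /= ?mul1r ?mul0r //.
Qed.

Lemma det_tensmx1 l (g : 'M[R]_2) : \det (tensmx g (1%:M : 'M_l)) = \det g ^+ l.
Proof.
rewrite -(det_mxsub_same _ _ (@half_row_inj l)); last by lia.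
rewrite (_ : mxsub _ _ _ = block_mx (diag_mx (const_mx (g 0 0)))
  (diag_mx (const_mx (g 0 1))) (diag_mx (const_mx (g 1 0)))
  (diag_mx (const_mx (g 1 1)))); last first.
  apply/matrixP => i j; rewrite !mxE /half_row.
  by case: (splitP i) => r ir; rewrite !mxE; case: (splitP j) => t jt;
    rewrite ?mxE !mxtens_indexK /= ?mxE mulr_natr.
rewrite det_block_diag; under eq_bigr do rewrite !mxE.
rewrite prodr_const card_ord (expand_det_row _ 0) big_ord2.
rewrite /cofactor !det_mx11 !mxE /= expr0 expr1 mul1r mulN1r mulrN.
by congr ((_ * g _ _ - _ * g _ _) ^+ l); apply: val_inj.
Qed.

(** The columns satisfy gA_c (x) B_c = (g (x) 1)(A_c (x) B_c). *)
Lemma seg_mull l (g : 'M[R]_2) (A : 'M[R]_(2, 2 * l)) (B : 'M[R]_(l, 2 * l)) :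
  Seg (g *m A) B = \det g ^+ l * Seg A B.
Proof.
rewrite !segE -det_tensmx1 -det_mulmx; congr (\det _).
apply/matrixP => r c; rewrite !mxE mulr_suml.
rewrite (reindex (@mxtens_index 2 l)) /=; last first.
  by exists (@mxtens_unindex 2 l) => ? _; rewrite (mxtens_indexK, mxtens_unindexK).
pose F a t := g (mxtens_unindex r).1 a * A a c *
  (((mxtens_unindex r).2 == t)%:R * B t c).
transitivity (\sum_a \sum_t F a t).
  apply: eq_bigr => a _; rewrite -mulr_sumr (bigD1 (mxtens_unindex r).2) //=.
  rewrite eqxx mul1r big1 ?addr0 // => t /negPf tr.
  by rewrite eq_sym tr mul0r.
rewrite pair_bigA; apply: eq_bigr => -[a t] _.
by rewrite /F !mxE mxtens_indexK /=; ring.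
Qed.

End SegreDeterminant.

Lemma det_homog (R : comNzRingType) m n (M : 'M[{mpoly R[m]}]_n) :
  (forall i j, M i j \is 1.-homog) -> \det M \is n.-homog.
Proof.
move=> M1; rewrite rpred_sum // => s _; rewrite -signr_odd mulr_sign.
have prod_homog : \prod_i M i (s i) \is (\sum_(i < n) 1).-homog.
  by elim/big_rec2: _ => [|i p d _]; [exact: dhomog1 | apply: dhomogM].
by rewrite sum1_card card_ord in prod_homog; case: ifP; rewrite ?rpredN.
Qed.

(** * Coordinates of Seg(A, .) and perfect matchings *)

Section SegreCoordinates.
Variables (C : numClosedFieldType) (l : nat).
Local Notation n := (2 * l)%N.
Local Notation S := {mpoly C[2 * n]}.
Local Notation B := {mpoly C[l * n]}.
Local Notation gen := (generic_mx C 2 l).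
Local Notation V := (gr_sections C 2 l).
Local Notation W := (coef_space C 2 l).

Lemma coefs_is_linear : linear (@coefs C 2 l : B -> W).
Proof. by move=> c F G; apply/ffunP => m; rewrite !ffunE mcoeffD mcoeffZ. Qed.

HB.instance Definition _ := GRing.isLinear.Build C B W _ (@coefs C 2 l)
  coefs_is_linear.

Definition selector_coefs (s : {ffun 'I_n -> 'I_2}) : W :=
  coefs (Seg (selector _ s) gen).

Lemma selector_coefs_mem s : selector_coefs s \in V.
Proof.
rewrite /selector_coefs; have [card_s|card_s] := eqVneq #|[set c | s c == 0]| l.
  have [b [f [g ->]]] := seg_selector_minors gen card_s.
  have fgV : coefs (max_minor gen f * max_minor gen g) \in V.
    rewrite memv_span //; apply/imageP.
    exists [ffun i => if i == 0 then f else g] => //.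
    by rewrite big_ord2 !ffunE.
  by rewrite mulr_sign; case: ifP; rewrite ?linearN ?memvN.
by rewrite seg_selector_eq0 // linear0 mem0v.
Qed.

Lemma seg_selector_homog (s : {ffun 'I_n -> 'I_2}) :
  Seg (selector _ s) gen \is n.-homog.
Proof.
rewrite segE; apply: det_homog => r c; rewrite !mxE; case: eqP => _.
  by rewrite mul1r dhomogX /= mdeg1.
by rewrite mul0r rpred0.
Qed.

(** Evaluation at [b] as a linear form on coefficient vectors, so that specializing [B] becomes
    linear algebra on the section space. *)
Definition coefs_eval (b : 'M[C]_(l, n)) (v : W) : C :=
  \sum_(m : 'X_{1..(l * n) < n.+1}) v m * \prod_i (mxvec b ord0 i) ^+ m i.

Lemma coefs_eval_is_linear b : linear_for *%R (coefs_eval b).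
Proof.
move=> c v w; rewrite /coefs_eval mulr_sumr -big_split.
by apply: eq_bigr => m _; rewrite !ffunE mulrDl mulrA.
Qed.

HB.instance Definition _ b := GRing.isLinear.Build C W C _ (coefs_eval b)
  (coefs_eval_is_linear b).

Lemma coefs_evalE b F : F \is n.-homog -> coefs_eval b (coefs F) = F.@[mxvec b ord0].
Proof.
move=> /dhomogP F_homog; rewrite [RHS](_ : _ = (\sum_(m : 'X_{1..(l * n) < n.+1})
  F@_m *: 'X_[m]).@[mxvec b ord0]); last first.
  congr (meval _ _); apply: mpolywE; rewrite msizeE.
  by apply/bigmax_leqP_seq => m /F_homog -> _.
rewrite linear_sum; apply: eq_bigr => m _ /=.
by rewrite mevalZ mevalX ffunE.
Qed.

Lemma coefs_seg (Z : 'M[C]_(2, n)) :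
  coefs (Seg (map_mx (fun a => a%:MP) Z) gen) =
  \sum_(s : {ffun 'I_n -> 'I_2}) (\prod_c Z (s c) c) *: selector_coefs s.
Proof.
rewrite seg_multilinear linear_sum; apply: eq_bigr => s _ /=.
rewrite -linearZ; congr coefs; rewrite -mul_mpolyC; congr (_ * _).
by rewrite rmorph_prod; apply: eq_bigr => c _; rewrite mxE.
Qed.

Lemma coefs_seg_mem (Z : 'M[C]_(2, n)) :
  coefs (Seg (map_mx (fun a => a%:MP) Z) gen) \in V.
Proof.
rewrite coefs_seg; apply: rpred_sum => s _.
exact/memvZ/selector_coefs_mem.
Qed.

Definition selector_monomial (s : {ffun 'I_n -> 'I_2}) : S :=
  \prod_c coord_var C (s c) c.

(** The i-th coordinate of Seg(Z, .) in the chosen basis, as a polynomial in the entries of Z. *)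
Definition seg_coord (i : 'I_(\dim V)) : S :=
  \sum_s coord (vbasis V) i (selector_coefs s) *: selector_monomial s.

Lemma selector_monomial_eval s (Z : 'M[C]_(2, n)) :
  (selector_monomial s).@[mxvec Z ord0] = \prod_c Z (s c) c.
Proof.
rewrite rmorph_prod; apply: eq_bigr => c _.
by rewrite /= /coord_var mevalXU mxvecE.
Qed.

Lemma seg_coord_eval i (Z : 'M[C]_(2, n)) : (seg_coord i).@[mxvec Z ord0] =
  coord (vbasis V) i (coefs (Seg (map_mx (fun a => a%:MP) Z) gen)).
Proof.
rewrite coefs_seg /seg_coord !linear_sum; apply: eq_bigr => s _ /=.
by rewrite mevalZ linearZ selector_monomial_eval mulrC.
Qed.

Lemma seg_coord_invariant i : SL2_invariants 1 (seg_coord i).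
Proof.
split=> [m|g det_g Z].
  rewrite mcoeff_msupp; apply: (_ : multihomog (fun=> 1%N) (seg_coord i)).
  apply: multihomog_sum => s _; apply: multihomogZ.
  have := multihomog_prod (r := index_enum 'I_n) (fun c => @multihomog_var C n (s c) c).
  apply: eq_multihomog => j; rewrite -[RHS](sum_indicator predT j).
  by apply: eq_bigr => c _; rewrite eq_sym.
have seg_g : Seg (map_mx (fun a => a%:MP) (g *m Z)) gen =
    Seg (map_mx (fun a => a%:MP) Z) gen :> B.
  have -> : map_mx (fun a => a%:MP) (g *m Z) =
      map_mx (fun a => a%:MP_[l * n]) g *m map_mx (fun a => a%:MP) Z.
    by rewrite map_mxM.
  by rewrite seg_mull det_map_mx det_g rmorph1 expr1n mul1r.
have eq_coord := congr1 (fun F => coord (vbasis V) i (coefs F)) seg_g.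
exact: etrans (seg_coord_eval i (g *m Z)) (etrans eq_coord (esym (seg_coord_eval i Z))).
Qed.

(** Evaluation at [b] is linear, so it is determined by its values on the basis vectors. *)
Lemma seg_coord_span (b : 'M[C]_(l, n)) :
  Seg (\matrix_(a, j) coord_var C a j) (map_mx (fun a => a%:MP) b) =
  \sum_(i < \dim V) coefs_eval b (vbasis V)`_i *: seg_coord i.
Proof.
rewrite seg_multilinear /seg_coord.
under [RHS]eq_bigr do rewrite scaler_sumr.
rewrite exchange_big; apply: eq_bigr => s _ /=.
under [RHS]eq_bigr do rewrite scalerA.
rewrite -scaler_suml mulrC -mul_mpolyC; congr (_ * _); last first.
  by apply: eq_bigr => c _; rewrite mxE.
have -> : Seg (selector _ s) (map_mx (fun a => a%:MP) b) =
    (Seg (selector C s) b)%:MP :> S.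
  rewrite !segE -det_map_mx; congr (\det _).
  by apply/matrixP => r c; rewrite !mxE rmorphM /= mpolyC_nat.
congr (_%:MP); transitivity (coefs_eval b (selector_coefs s)).
  rewrite coefs_evalE ?seg_selector_homog // !segE -det_map_mx.
  by congr (\det _); apply/matrixP => r c; rewrite !mxE rmorphM /= rmorph_nat
    mevalXU mxvecE.
rewrite {1}(coord_vbasis (selector_coefs_mem s)) linear_sum.
by apply: eq_bigr => i _; rewrite linearZ /= mulrC.
Qed.

Lemma matching_span (t : seq ('I_n * 'I_n)) : perfect_matching t ->
  exists c : 'I_(\dim V) -> C, bracket_monomial C t = \sum_i c i *: seg_coord i.
Proof.
move=> t_perf; have size_t : size t == l.
  have := sum_edge_degree setT t; under eq_bigr do rewrite t_perf.
  rewrite sum1_card cardsT card_ord; under eq_bigr do rewrite !inE.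
  by rewrite big_split /= sum1_size => ?; apply/eqP; lia.
pose T := Tuple size_t; pose x r := (tnth T r).1; pose y r := (tnth T r).2.
pose q (i : 'I_(l + l)) := match split i with inl r => x r | inr r => y r end.
have q_x r : q (lshift l r) = x r by rewrite /q (unsplitK (inl r)).
have q_y r : q (rshift l r) = y r by rewrite /q (unsplitK (inr r)).
have sum_q j : (\sum_i (q i == j) = 1)%N.
  apply: etrans (t_perf j); rewrite /edge_degree -[t]/(tval T) big_tuple big_split_ord big_split.
  by congr (_ + _)%N; apply: eq_bigr => r _; rewrite ?q_x ?q_y.
have q_inj : injective q.
  move=> i i' qq; apply/eqP; apply: contraT => ii'.
  have := sum_q (q i); rewrite (bigD1 i) //= (bigD1 i') 1?eq_sym //=.
  by rewrite qq !eqxx; lia.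
have half_x r : half_row (lshift l r) = mxtens_index (0 : 'I_2, r).
  by rewrite /half_row (unsplitK (inl r)).
have half_y r : half_row (rshift l r) = mxtens_index (1 : 'I_2, r).
  by rewrite /half_row (unsplitK (inr r)).
have xx r r' : (x r == x r') = (r == r').
  by rewrite -!q_x (inj_eq q_inj) (inj_eq (@lshift_inj _ _)).
have yy r r' : (y r == y r') = (r == r').
  by rewrite -!q_y (inj_eq q_inj) (inj_eq (@rshift_inj _ _)).
have xy r r' : (x r == y r') = false.
  by rewrite -q_x -q_y (inj_eq q_inj) eq_lrshift.
(* Columns x_r and y_r are both e_r. With the columns ordered by [q], the Segre matrix has four
   diagonal blocks, and its determinant is a product of brackets. *)
pose b : 'M[C]_(l, n) := \matrix_(r, c) ((x r == c) || (y r == c))%:R.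
have [|e det_e] := det_mxsub_bij (segre_mx (\matrix_(a, j) coord_var C a j)
  (map_mx (fun a => a%:MP_[2 * n]) b)) _ (@half_row_inj l) q_inj; first by lia.
have block : mxsub (@half_row l) q (segre_mx (\matrix_(a, j) coord_var C a j)
    (map_mx (fun a => a%:MP_[2 * n]) b)) =
  block_mx (diag_mx (\row_r coord_var C 0 (x r))) (diag_mx (\row_r coord_var C 0 (y r)))
    (diag_mx (\row_r coord_var C 1 (x r))) (diag_mx (\row_r coord_var C 1 (y r))).
  apply/matrixP => i j; rewrite mxE.
  by case: (split_ordP i) => r ->; case: (split_ordP j) => r' ->;
    rewrite ?block_mxEul ?block_mxEur ?block_mxEdl ?block_mxEdr ?half_x ?half_y
      ?q_x ?q_y !mxE mxtens_indexK /= ?xx ?yy ?xy ?[y r == x _]eq_sym ?xy ?orbF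
      mpolyC_nat mulr_natr; case: (r =P r') => [->|].
exists (fun i => (-1) ^+ e * coefs_eval b (vbasis V)`_i).
under eq_bigr do rewrite -scalerA.
rewrite -scaler_sumr -seg_coord_span segE det_e block det_block_diag.
rewrite -mul_mpolyC rmorph_sign mulrA -expr2 sqrr_sign mul1r.
rewrite /bracket_monomial -[t]/(tval T) big_tuple; apply: eq_bigr => r _.
by rewrite !mxE /bracket; congr (_ - _); apply: mulrC.
Qed.

End SegreCoordinates.

(** * The graded ring of invariants *)

Section InvariantRing.
Variables (C : numClosedFieldType) (n : nat).
Local Notation S := {mpoly C[2 * n]}.
Implicit Types (d e : nat) (f g : S).

Lemma SL2_invariantsE d f : SL2_invariants d f <->
  multihomog (fun=> d) f /\ SL2_invariant f.
Proof.
by split=> -[df f_inv]; split=> // m; have := df m; rewrite mcoeff_msupp.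
Qed.

Lemma SL2_invariants0 d : SL2_invariants d (0 : S).
Proof.
by apply/SL2_invariantsE; split=> [|g _ Z]; [exact: multihomog0 | rewrite !meval0].
Qed.

Lemma SL2_invariants1 : SL2_invariants 0 (1 : S).
Proof.
by apply/SL2_invariantsE; split=> [|g _ Z]; [exact: multihomog1 | rewrite !meval1].
Qed.

Lemma SL2_invariantsD d f g :
  SL2_invariants d f -> SL2_invariants d g -> SL2_invariants d (f + g).
Proof.
move=> /SL2_invariantsE[df f_inv] /SL2_invariantsE[dg g_inv].
apply/SL2_invariantsE; split=> [|h h1 Z]; first exact: multihomogD.
by rewrite !mevalD f_inv ?g_inv.
Qed.

Lemma SL2_invariantsZ d c f : SL2_invariants d f -> SL2_invariants d (c *: f).
Proof.
move=> /SL2_invariantsE[df f_inv].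
apply/SL2_invariantsE; split=> [|h h1 Z]; first exact: multihomogZ.
by rewrite !mevalZ f_inv.
Qed.

Lemma SL2_invariantsM d e f g :
  SL2_invariants d f -> SL2_invariants e g -> SL2_invariants (d + e) (f * g).
Proof.
move=> /SL2_invariantsE[df f_inv] /SL2_invariantsE[dg g_inv].
apply/SL2_invariantsE; split=> [|h h1 Z]; first exact: multihomogM.
by rewrite !mevalM f_inv ?g_inv.
Qed.

End InvariantRing.

(** * The graded surjection from C[y] to the invariants *)

Section SegreParametrization.
Variables (C : numClosedFieldType) (l : nat).
Local Notation n := (2 * l)%N.
Local Notation S := {mpoly C[2 * n]}.
Local Notation V := (gr_sections C 2 l).
Local Notation N := (\dim V).
Local Notation Y := {mpoly C[N]}.
Implicit Types (H : Y).

Definition seg_coords : N.-tuple S := [tuple @seg_coord C l i | i < N].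
Local Notation segre_param := (comp_mpoly seg_coords).

Lemma segre_paramX i : segre_param 'X_i = seg_coord i.
Proof. by rewrite comp_mpolyXU -tnth_nth tnth_mktuple. Qed.

Lemma segre_param_eval H v :
  (segre_param H).@[v] = H.@[fun i => (@seg_coord C l i).@[v]].
Proof.
by rewrite comp_mpoly_meval; apply: meval_eq => i; rewrite tnth_mktuple.
Qed.

Lemma segre_param_invariant d H :
  H \is d.-homog -> SL2_invariants d (segre_param H).
Proof.
move=> /dhomogP H_homog; rewrite (mpolyE H) linear_sum big_seq.
elim/big_ind: _ => [|f g|m mH]; [exact: SL2_invariants0 | exact: SL2_invariantsD|].
rewrite linearZ; apply: SL2_invariantsZ; rewrite -(H_homog _ mH).
rewrite /= mpolyXE_id rmorph_prod mdegE.
elim/big_rec2: _ => [|i e f _ IH]; first exact: SL2_invariants1.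
apply: SL2_invariantsM IH; rewrite rmorphXn /= segre_paramX.
elim: (m i) => [|k IHk]; first exact: SL2_invariants1.
by rewrite exprS; apply: (SL2_invariantsM (seg_coord_invariant i)).
Qed.

(** A concrete perfect matching, used to show that Seg(A, .) is nonzero when all minors of A are. *)
Definition half_matching : seq ('I_n * 'I_n) :=
  [seq (half_row (lshift l r), half_row (rshift l r)) | r <- enum 'I_l].

Lemma half_matching_perfect : perfect_matching half_matching.
Proof.
move=> j; rewrite /edge_degree big_map big_enum big_split /=.
have [h hK Kh] : bijective (@half_row l).
  by apply: inj_card_bij (@half_row_inj l) _; rewrite !card_ord; lia.
transitivity (\sum_(i < l + l) (half_row i == j))%N; first by rewrite big_split_ord.
rewrite (bigD1 (h j)) //= Kh eqxx big1 // => i ij.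
by apply/eqP; rewrite eqb0; apply: contra ij => /eqP <-; rewrite hK.
Qed.

Lemma segre_param_matching t : perfect_matching t ->
  exists2 H, H \is 1.-homog & segre_param H = bracket_monomial C t.
Proof.
move=> /(@matching_span C)[c ->]; exists (\sum_i c i *: 'X_i).
  by apply: rpred_sum => i _; rewrite dhomogZ // dhomogX /= mdeg1.
rewrite linear_sum; apply: eq_bigr => i _.
by rewrite linearZ /= segre_paramX.
Qed.

Lemma segre_param_surj d (f : S) : SL2_invariants d f ->
  exists2 H, H \is d.-homog & segre_param H = f.
Proof.
move=> /SL2_invariantsE[df f_inv].
have [r -> r_deg] := multihomog_bracket_span df (bracket_span_SL2_invariant df f_inv).
pose Q e (g : S) := exists2 H, H \is e.-homog & segre_param H = g.
have QD e g g' : Q e g -> Q e g' -> Q e (g + g').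
  by move=> [H He <-] [H' He' <-]; exists (H + H'); rewrite ?rpredD ?linearD.
have QZ e c g : Q e g -> Q e (c *: g).
  by move=> [H He <-]; exists (c *: H); rewrite ?dhomogZ ?linearZ.
have Q1 : Q 0 1 by exists 1; [exact: dhomog1 | exact: rmorph1].
have QM e t g : perfect_matching t -> Q e g -> Q e.+1 (bracket_monomial C t * g).
  move=> /segre_param_matching[H H1 <-] [H' He <-]; exists (H * H').
    exact: dhomogM H1 He.
  exact: rmorphM.
pose X := [set half_row (lshift l r) | r : 'I_l].
have card_X : #|X| = l.
  rewrite card_imset ?card_ord // => a a' /half_row_inj; exact: lshift_inj.
have X_half : #|X| = #|~: X|.
  by have := cardsC X; rewrite card_X card_ord; lia.
rewrite big_seq; apply: (big_ind (Q d)) => [||p pr].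
- by exists 0; rewrite ?rpred0 ?linear0.
- exact: QD.
- by apply: (QZ d); apply: (kempe X_half Q1 QD QZ QM); apply: r_deg.
Qed.

(** The degree of a component of [H] can be read off its image as the degree in any one column, so
    images of different components cannot cancel. Positivity of l provides the column. *)
Lemma segre_param_ker d H : (0 < l)%N ->
  segre_param H = 0 -> segre_param (pihomog mdeg d H) = 0.
Proof.
move=> l_gt0 H0; have n_gt0 : (0 < n)%N by lia.
pose j0 : 'I_n := Ordinal n_gt0.
apply/mpolyP => m; rewrite mcoeff0; apply/eqP; apply: contraT => Hdm.
have deg e : (segre_param (pihomog mdeg e H))@_m != 0 -> column_degree m j0 = e.
  have /SL2_invariantsE[eH _] := segre_param_invariant (pihomogP mdeg e H).
  by move/eH/(_ j0).
(* The range of summation is enlarged to contain [d] even beyond the size of [H]. *)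
have d_lt : (d < maxn (msize H) d.+1)%N by rewrite leq_maxr.
have H_sum : segre_param H =
    \sum_(e < maxn (msize H) d.+1) segre_param (pihomog mdeg e H).
  by rewrite -linear_sum -pihomog_partitionE // leq_maxl.
have := congr1 (mcoeff m) H_sum; rewrite H0 mcoeff0 (raddf_sum (mcoeff m)).
rewrite (bigD1 (Ordinal d_lt)) //= big1 ?addr0 => [/eqP|].
  by rewrite eq_sym (negPf Hdm).
move=> e ed; apply/eqP; apply: contraT => Hem.
by case/eqP: ed; apply: val_inj; rewrite /= -(deg e Hem) (deg d Hdm).
Qed.

End SegreParametrization.

(** * A Nullstellensatz over an uncountable field *)

Section Nullstellensatz.
Variable C : numClosedFieldType.
(* Uncountability of C: some fibre of any map to nat is infinite. *)
Hypothesis infinite_fibre : forall h : C -> nat,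
  exists d, forall N, exists s : seq C,
    [/\ uniq s, size s = N & {in s, forall c, h c = d}].
Variable n : nat.
Local Notation S := {mpoly C[n]}.

Record proper_ideal (J : S -> Prop) : Prop := ProperIdeal {
  ideal0 : J 0;
  idealD : forall f g, J f -> J g -> J (f + g);
  idealM : forall f g, J g -> J (f * g);
  ideal_proper : ~ J 1 }.

Definition adjoin (J : S -> Prop) (f : S) : S -> Prop :=
  fun p => exists g h, J g /\ p = g + f * h.

Lemma adjoin_ideal J f : proper_ideal J -> ~ adjoin J f 1 ->
  proper_ideal (adjoin J f).
Proof.
move=> J_ideal not1; split=> // [|p q [g [h [Jg ->]]] [g' [h' [Jg' ->]]]|].
- by exists 0, 0; split; [exact: ideal0 | ring].
- by exists (g + g'), (h + h'); split; [exact: idealD | ring].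
- move=> p q [g [h [Jg ->]]].
  by exists (p * g), (p * h); split; [exact: idealM | ring].
Qed.

Lemma linear_dependence (I : finType) (s : seq C) (v : C -> I -> C) :
    uniq s -> (#|I| < size s)%N ->
  exists a : C -> C, (exists2 c, c \in s & a c != 0) /\
    forall i, \sum_(c <- s) a c * v c i = 0.
Proof.
move=> s_uniq lt_s; pose A : 'M[C]_(size s, #|I|) :=
  \matrix_(k, i) v s`_k (enum_val i).
have /rowV0Pn[u u_ker u_neq0] : kermx A != 0.
  rewrite kermx_eq0 -row_leq_rank -ltnNge.
  exact: leq_ltn_trans (rank_leq_col A) lt_s.
have s_index (k : 'I_(size s)) : index s`_k s = k by rewrite index_uniq.
pose a c := \sum_(k < size s | s`_k == c) u 0 k.
have aE (k : 'I_(size s)) : a s`_k = u 0 k.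
  rewrite /a (bigD1 k) //= big1 ?addr0 // => k' /andP[/eqP kk' /negP[]].
  by apply/eqP/val_inj; rewrite /= -(s_index k') kk' s_index.
exists a; split.
  have /existsP[k uk] : [exists k, u 0 k != 0].
    apply: contraNT u_neq0 => /existsPn u0; apply/eqP/rowP => k.
    by rewrite mxE; apply/eqP; rewrite -[_ == _]negbK.
  by exists s`_k; rewrite ?mem_nth ?aE.
move=> i; have /sub_kermxP/rowP/(_ (enum_rank i)) := u_ker.
rewrite !mxE => uA0; rewrite (big_nth 0) big_mkord -[RHS]uA0.
by apply: eq_bigr => k _; rewrite aE mxE enum_rankK.
Qed.

(* Otherwise 1 - (y - c) h_c lies in J for every c, with h_c of bounded degree
   for infinitely many c. A linear relation between these h_c, multiplied by the
   product of the y - c, gives a nonzero polynomial in y in J; but all its linear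
   factors are invertible modulo J. *)
Lemma proper_adjoin J y : proper_ideal J ->
  exists c, proper_ideal (adjoin J (y - c%:MP)).
Proof.
move=> J_ideal; have [//|all1] := pselect (exists c, proper_ideal (adjoin J (y - c%:MP))).
exfalso.
have inv_y c : exists h, J (1 - (y - c%:MP) * h).
  have [[g [h [Jg eq1]]]|] := pselect (adjoin J (y - c%:MP) 1).
    by exists h; rewrite eq1 addrK.
  by move/(adjoin_ideal J_ideal) => H; case: all1; exists c.
have [h hJ] := choice inv_y.
have [d /(_ #|{: 'X_{1..n < d}}|.+1) [s [s_uniq size_s s_d]]] :=
  infinite_fibre (fun c => msize (h c)).
have [|a [[c0 c0s ac0] a_dep]] :=
  linear_dependence (fun c (m : 'X_{1..n < d}) => (h c)@_m) s_uniq.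
  by rewrite size_s.
have sum_ah : \sum_(c <- s) a c *: h c = 0.
  apply/mpolyP => m; rewrite mcoeff0 raddf_sum /=.
  under eq_bigr do rewrite mcoeffZ.
  have [md|md] := ltnP (mdeg m) d; first exact: (a_dep (BMultinom md)).
  rewrite big_seq big1 // => c cs.
  by rewrite (memN_msupp_eq0 (msize_mdeg_ge _)) ?mulr0 // s_d.
pose P c : {poly C} := \prod_(z <- rem c s) ('X - z%:P).
pose q := \sum_(c <- s) a c *: P c.
pose ev := horner_alg y.
have ev_XsubC z : ev ('X - z%:P) = y - z%:MP.
  by rewrite /ev rmorphB /= horner_algX horner_algC alg_mpolyC.
(* At [c0] every other summand vanishes, and the remaining one is [a c0] times a product of nonzero
   differences. *)
have q_neq0 : q != 0.
  apply: contraTneq isT => /(congr1 (horner^~ c0)); rewrite horner0 => q0.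
  suff : a c0 * (P c0).[c0] != 0.
    move=> /eqP[]; rewrite -[RHS]q0 horner_sum (bigD1_seq c0) //= hornerZ.
    rewrite big1_seq ?addr0 // => c /andP[cc0 cs]; rewrite hornerZ.
    rewrite /P horner_prod (big_rem c0) /=; last first.
      by rewrite mem_rem_uniq // inE eq_sym cc0.
    by rewrite hornerXsubC subrr mul0r mulr0.
  rewrite mulf_neq0 // /P horner_prod prodf_seq_neq0.
  apply/allP => z; rewrite mem_rem_uniq // inE => /andP[zc0 _].
  by rewrite hornerXsubC subr_eq0 eq_sym.
have Jev : J (ev q).
  (* The terms subtracted on the right share the factor prod (y - z), and they add up to it times
     the relation sum a_c h_c = 0. *)
  have -> : ev q = \sum_(c <- s) a c *: (ev (P c) * (1 - (y - c%:MP) * h c)).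
    under [RHS]eq_bigr do rewrite mulrBr mulr1 scalerBr.
    rewrite sumrB [X in _ = _ - X](_ : _ =
      ev (\prod_(z <- s) ('X - z%:P)) * \sum_(c <- s) a c *: h c).
      rewrite sum_ah mulr0 subr0 /q /ev linear_sum.
      by apply: eq_bigr => c _; rewrite linearZ /= mulr_algl.
    rewrite mulr_sumr big_seq [RHS]big_seq; apply: eq_bigr => c cs.
    rewrite -scalerAr mulrA -ev_XsubC -rmorphM /= /P.
    by rewrite [in RHS](big_rem c) //= [X in ev X]mulrC.
  elim/big_rec: _ => [|c f _ Jf]; first exact: ideal0.
  apply: (idealD J_ideal) Jf.
  by rewrite -mul_mpolyC; do 2![apply: (idealM J_ideal)].
have [rs q_eq] := closed_field_poly_normal q.
have J_prod r : J (\prod_(z <- r) (y - z%:MP)) -> J 1.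
  elim: r => [|z r IHr]; rewrite ?big_nil // big_cons => Jzr; apply: IHr.
  have -> : \prod_(z <- r) (y - z%:MP) =
      \prod_(z <- r) (y - z%:MP) * (1 - (y - z%:MP) * h z) +
      h z * ((y - z%:MP) * \prod_(z <- r) (y - z%:MP)) by ring.
  by apply: (idealD J_ideal); apply: (idealM J_ideal).
apply: (ideal_proper J_ideal); apply: (J_prod rs).
have -> : \prod_(z <- rs) (y - z%:MP) = (lead_coef q)^-1%:MP * ev q.
  rewrite [in ev q]q_eq /ev linearZ /= mulr_algl mul_mpolyC scalerA mulVf ?lead_coef_eq0 //.
  by rewrite scale1r rmorph_prod; apply: eq_bigr => z _; rewrite -ev_XsubC.
exact: idealM.
Qed.

(** Adjoining some 'X_k - v_k for each variable in turn keeps the ideal proper. In the end every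
    polynomial is congruent to its value at v, and a nonzero constant would make the ideal
    improper. *)
Theorem weak_nullstellensatz J : proper_ideal J ->
  exists v : 'I_n -> C, forall f, J f -> f.@[v] = 0.
Proof.
move=> J_ideal.
have fix_vars k : (k <= n)%N -> exists v J', [/\ proper_ideal J',
    forall f, J f -> J' f & forall i : 'I_n, (i < k)%N -> J' ('X_i - (v i)%:MP)].
  elim: k => [_|k IHk lt_kn]; first by exists (fun=> 0), J.
  have [v [J' [J'_ideal JJ' J'v]]] := IHk (ltnW lt_kn).
  have [c c_ideal] := proper_adjoin 'X_(Ordinal lt_kn) J'_ideal.
  exists (fun i : 'I_n => if i == k :> nat then c else v i).
  eexists; split; first exact: c_ideal.
    move=> f /JJ' J'f; exists f, 0; split=> //; ring.
  move=> i; rewrite ltnS leq_eqVlt; case: eqP => [ik _|_ /= ik].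
    have -> : i = Ordinal lt_kn by apply: val_inj.
    by exists 0, 1; split; [exact: ideal0 | ring].
  by exists ('X_i - (v i)%:MP), 0; split; [exact: J'v | ring].
have [v [J' [J'_ideal JJ' J'v]]] := fix_vars n (leqnn n).
exists v => f /JJ' J'f; apply/eqP; apply: contraT => fv.
have J'sub g : J' (g - (g.@[v])%:MP).
  elim/mpoly_alg_ind: g => [c|i|g h Jg Jh|g h Jg Jh].
  - by rewrite mevalC subrr; apply: ideal0.
  - by rewrite mevalXU; apply: J'v.
  - rewrite mevalD mpolyCD opprD addrACA; exact: idealD.
  - rewrite mevalM mpolyCM.
    have -> : g * h - g.@[v]%:MP * h.@[v]%:MP =
      h * (g - g.@[v]%:MP) + g.@[v]%:MP * (h - h.@[v]%:MP) by ring.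
    by apply: (idealD J'_ideal); apply: (idealM J'_ideal).
case: (ideal_proper J'_ideal).
have -> : 1 = (f.@[v])^-1%:MP * (f + -1 * (f - f.@[v]%:MP)) :> S.
  rewrite mulN1r opprB addrC subrK -mpolyCM mulVf //.
by apply: idealM => //; apply: idealD => //; apply: idealM.
Qed.

End Nullstellensatz.

Import classical_sets.
Local Open Scope classical_set_scope.
Local Open Scope ring_scope.

(** * Uncountability of the complex numbers *)

Section Uncountability.
Variable R : realType.
Local Notation C := R[i].

(* Otherwise nested intervals avoiding the fibres one after the other have a
   common point. *)
Lemma infinite_fibre_complex (h : C -> nat) :
  exists d, forall N, exists s : seq C,
    [/\ uniq s, size s = N & {in s, forall c, h c = d}].
Proof.
apply/not_existsP => finite_fibre.
(* The condition on [ab] stands under the existential so that choice yields a total function. The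
   interval is cut into [N] equal parts, whose closed left halves are disjoint; if all of them met
   the fibre of [d], it would have [N] distinct points. *)
have step (d : nat) (ab : R * R) : exists ab' : R * R, ab.1 < ab.2 ->
    [/\ ab.1 <= ab'.1, ab'.2 <= ab.2, ab'.1 < ab'.2 &
      forall x, ab'.1 <= x <= ab'.2 -> h x%:C%C <> d].
  have /existsNP[N noN] := finite_fibre d.
  have [ab_lt|_] := boolP (ab.1 < ab.2); last by exists ab.
  have N_gt0 : (0 < N)%N.
    by rewrite lt0n; apply/eqP => N0; apply: noN; exists [::]; rewrite N0.
  pose w := (ab.2 - ab.1) / N%:R.
  have w_gt0 : 0 < w by rewrite divr_gt0 ?subr_gt0 ?ltr0n.
  have Nw : ab.1 + N%:R * w = ab.2.
    by rewrite /w mulrCA divff ?pnatr_eq0 ?gtn_eqF // mulr1 addrC subrK.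
  have [[k [kN H]]|all_k] := pselect (exists k, (k < N)%N /\ forall x,
      ab.1 + k%:R * w <= x <= ab.1 + k%:R * w + w / 2 -> h x%:C%C <> d).
    exists (ab.1 + k%:R * w, ab.1 + k%:R * w + w / 2) => _; split=> //=.
    - by rewrite lerDl mulr_ge0 // ltW.
    - rewrite -Nw -addrA lerD2l; apply: le_trans (_ : k.+1%:R * w <= _).
        by rewrite -[k.+1%:R]natr1 mulrDl mul1r lerD2l; lra.
      by rewrite ler_pM2r // ler_nat.
    - by rewrite ltrDl divr_gt0.
  have pick k : exists x, (k < N)%N -> ab.1 + k%:R * w <= x <= ab.1 + k%:R * w + w / 2
      /\ h x%:C%C = d.
    have [kN|_] := boolP (k < N)%N; last by exists 0.
    have [[x xP]|no_x] := pselect (exists x, ab.1 + k%:R * w <= x <=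
        ab.1 + k%:R * w + w / 2 /\ h x%:C%C = d); first by exists x.
    case: all_k; exists k; split=> // x xk hx; apply: no_x; by exists x.
  have [x xP] := choice pick; case: noN.
  exists [seq (x k)%:C%C | k <- iota 0 N]; split.
  - rewrite map_inj_in_uniq ?iota_uniq // => j k.
    rewrite !mem_iota /= !add0n => jN kN [xjk].
    have := xP j jN; have := xP k kN; rewrite xjk => -[/andP[xk1 xk2] _].
    case=> /andP[xj1 xj2] _.
    have lt_jk (a b : nat) : (a < b)%N -> ab.1 + b%:R * w <= x k ->
        x k <= ab.1 + a%:R * w + w / 2 -> False.
      rewrite -(ler_nat R) -[a.+1%:R]natr1 => ab_le xb xa.
      have : (a%:R + 1) * w <= b%:R * w by rewrite ler_pM2r.
      by rewrite mulrDl mul1r; lra.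
    by case: (ltngtP j k) => // [/lt_jk|/lt_jk]; case/(_ _ _).
  - by rewrite size_map size_iota.
  - by move=> c /mapP[k]; rewrite mem_iota add0n => /= kN ->; have [] := xP k kN.
have [g gP] := choice (fun p : nat * (R * R) => step p.1 p.2).
pose u := fix u d := if d is d'.+1 then g (d', u d') else (0, 1) : R * R.
have u_lt d : (u d).1 < (u d).2.
  by elim: d => [|d IHd] /=; [exact: ltr01 | have [] := gP (d, u d) IHd].
have u_mono d e : (d <= e)%N -> (u d).1 <= (u e).1 /\ (u e).2 <= (u d).2.
  elim: e => [|e IHe]; first by rewrite leqn0 => /eqP ->.
  rewrite leq_eqVlt => /orP[/eqP -> //|/IHe[le1 le2]] /=.
  have [ge1 ge2 _ _] := gP (e, u e) (u_lt e).
  by split; [exact: le_trans le1 ge1 | exact: le_trans ge2 le2].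
have u_ub e : ubound (range (fun d => (u d).1)) (u e).2.
  move=> _ [d _ <-]; have [d_max _] := u_mono _ _ (leq_maxl d e).
  have [_ e_max] := u_mono _ _ (leq_maxr d e).
  exact: le_trans d_max (le_trans (ltW (u_lt _)) e_max).
pose x := sup (range (fun d => (u d).1)).
have x_in d : (u d).1 <= x <= (u d).2.
  apply/andP; split.
    apply: ub_le_sup; last by exists d.
    by exists (u 0%N).2; apply: u_ub.
  apply: ge_sup; last exact: u_ub.
  by exists (u 0%N).1, 0%N.
(* [x] lies in every interval, in particular in the one chosen to avoid the fibre of its own value
   under [h]. *)
have [_ _ _ H] := gP (h x%:C%C, u (h x%:C%C)) (u_lt _).
exact: (H x (x_in (h x%:C%C).+1)).
Qed.

End Uncountability.

(** * Homogeneous primes of a polynomial ring and their zeros *)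

Section GradedPrimes.
Variables (C : numClosedFieldType) (n : nat).
Local Notation S := {mpoly C[n]}.
Local Notation "H ^_( d )" := (pihomog mdeg d H) (at level 3, format "H ^_( d )").

Record relevant_prime (J : S -> Prop) : Prop := RelevantPrime {
  rprime_ideal : proper_ideal J;
  rprime_prime : forall f g, J (f * g) -> J f \/ J g;
  rprime_homog : forall f d, J f -> J f^_(d);
  rprime_relevant : exists i, ~ J 'X_i }.

(* The kernel of this morphism to a domain is the homogeneous prime of the
   point c. *)
Definition line_restriction (c : 'I_n -> C) (H : S) : {poly C} :=
  mmap polyC (fun i => c i *: 'X) H.

Lemma line_restriction_is_linear c : linear (line_restriction c).
Proof. by move=> a f g; rewrite /line_restriction mmapD mmapZ mul_polyC. Qed.

HB.instance Definition _ c := GRing.isLinear.Build C S {poly C} _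
  (line_restriction c) (line_restriction_is_linear c).

Lemma line_restrictionM c f g :
  line_restriction c (f * g) = line_restriction c f * line_restriction c g.
Proof. exact: rmorphM. Qed.

(** A component of degree d satisfies H_d(ct) = t^d H_d(c). *)
Lemma coef_line_restriction c H d : (line_restriction c H)`_d = H^_(d).@[c].
Proof.
elim/mpolyind: H => [|a m p _ _ IHp]; first by rewrite !linear0 coef0.
rewrite !linearP /= coefD coefZ IHp; congr (_ * _ + _).
rewrite /line_restriction mmapX /mmap1 pihomogX /=.
under eq_bigr do rewrite exprZn.
rewrite scaler_prod prodrXr -mdegE coefZ coefXn eq_sym.
by case: eqP => _; rewrite ?mulr1 ?mulr0 ?mevalX ?meval0.
Qed.

Lemma line_restriction_eq0 c H :
  line_restriction c H = 0 <-> forall d, H^_(d).@[c] = 0.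
Proof.
split=> [H0 d|H0]; first by rewrite -coef_line_restriction H0 coef0.
by apply/polyP => d; rewrite coef_line_restriction H0 coef0.
Qed.

Lemma line_restriction_homog c d H : H \is d.-homog ->
  line_restriction c H = 0 <-> H.@[c] = 0.
Proof.
move=> H_homog; rewrite line_restriction_eq0; split=> [/(_ d)|H0 e].
  by rewrite pihomog_dE.
have [<-|de] := eqVneq d e; first by rewrite pihomog_dE.
by rewrite (pihomog_ne0 de) // meval0.
Qed.

Lemma line_restriction_prime c : (exists i, c i != 0) ->
  relevant_prime (fun H => line_restriction c H = 0).
Proof.
move=> [i ci]; split.
- split=> [|f g f0 g0|f g g0|].
  + exact: linear0.
  + by rewrite linearD /= f0 g0 addr0.
  + by rewrite line_restrictionM g0 mulr0.
  + by rewrite /line_restriction rmorph1 => /eqP; rewrite oner_eq0.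
- move=> f g /eqP; rewrite line_restrictionM mulf_eq0.
  by case/orP => /eqP; [left | right].
- move=> f d /line_restriction_eq0 f0.
  by apply/(line_restriction_homog _ (pihomogP _ _ _)).
- exists i; rewrite /line_restriction mmapX mmap1U => /eqP.
  by rewrite scaler_eq0 polyX_eq0 orbF (negPf ci).
Qed.

Lemma ideal_mnm_factor (J : S -> Prop) : proper_ideal J ->
  (forall i, J 'X_i) -> forall d H, (0 < d)%N -> H \is d.-homog -> J H.
Proof.
move=> J_ideal JX d H d_gt0 /dhomogP H_homog; rewrite (mpolyE H) big_seq.
elim/big_ind: _ => [|f g|m mH]; [exact: ideal0 | exact: idealD|].
rewrite -mul_mpolyC; apply: (idealM J_ideal).
have [i mi] : exists i, m i != 0%N.
  apply/existsP; apply: contraTT d_gt0; rewrite negb_exists => /forallP m0.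
  rewrite -(H_homog _ mH) -leqNgt leqn0 mdeg_eq0; apply/eqP/mnmP => i.
  by rewrite mnm0E; apply/eqP; rewrite -[_ == _]negbK.
by rewrite -(@submK _ U_(i) m) ?lep1mP // mpolyXD; apply: idealM.
Qed.

Lemma idealB (J : S -> Prop) f g : proper_ideal J -> J f -> J g -> J (f - g).
Proof.
by move=> J_ideal Jf Jg; rewrite -mulN1r; apply: idealD => //; apply: idealM.
Qed.

Lemma rprime_exp (J : S -> Prop) f k : relevant_prime J -> J (f ^+ k) -> J f.
Proof.
move=> J_prime; elim: k => [|k IHk]; last by rewrite exprS => /rprime_prime[].
by move/(ideal_proper (rprime_ideal J_prime)).
Qed.

(** The forms c_k X_i - c_i X_k vanish at c, so a relevant J cannot contain X_k. If G in J has
    degree d and G(c) != 0, then c_k^d G - G(c) X_k^d vanishes at c, which puts X_k^d, hence X_k, in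
    J. *)
Lemma line_restriction_maximal c (J : S -> Prop) : (exists i, c i != 0) ->
    relevant_prime J -> (forall H, line_restriction c H = 0 -> J H) ->
  forall H, J H -> line_restriction c H = 0.
Proof.
move=> [k ck] J_prime cJ; have J_ideal := rprime_ideal J_prime.
have unitJ (a : C) f : a != 0 -> J (a *: f) -> J f.
  move=> a0 Jaf; rewrite -[f]scale1r -(mulVf a0) -scalerA -mul_mpolyC.
  exact: idealM.
have homog_c e (f : S) : f \is e.-homog -> f.@[c] = 0 -> J f.
  by move=> f_homog fc; apply/cJ/(line_restriction_homog _ f_homog).
have Xhomog i : ('X_i : S) \is 1.-homog by rewrite dhomogX /= mdeg1.
have J'Xk : ~ J 'X_k.
  move=> JXk; have [i []] := rprime_relevant J_prime.
  apply: (unitJ (c k)) => //; rewrite -[_ *: _](subrK (c i *: 'X_k)).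
  apply: (idealD J_ideal); last by rewrite -mul_mpolyC; apply: idealM.
  apply: (homog_c 1%N); first by rewrite rpredB // dhomogZ.
  by rewrite mevalB !mevalZ !mevalXU mulrC subrr.
move=> H JH; apply/line_restriction_eq0 => d; apply/eqP; apply: contraT => Hc.
have := rprime_homog J_prime d JH; move: Hc; set G := pihomog _ d H => Gc JG.
have G_homog : G \is d.-homog by apply: pihomogP.
case: J'Xk; apply: (rprime_exp (k := d) J_prime); apply: (unitJ G.@[c]) => //.
have -> : G.@[c] *: 'X_k ^+ d =
    (c k ^+ d)%:MP * G - (c k ^+ d *: G - G.@[c] *: 'X_k ^+ d) :> S.
  by rewrite mul_mpolyC subKr.
apply: idealB => //; first exact: idealM.
apply: (homog_c d).
  by rewrite rpredB // dhomogZ // -[d in d.-homog]mul1n dhomogMn.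
by rewrite mevalB !mevalZ rmorphXn /= mevalXU mulrC subrr.
Qed.

Lemma pihomogXM k e (h : S) : ('X_k * h)^_(e.+1) = 'X_k * h^_(e).
Proof.
elim/mpolyind: h => [|a m p _ _ IHp]; first by rewrite mulr0 !linear0 mulr0.
rewrite mulrDr -scalerAr !linearP /= IHp mulrDr -scalerAr; congr (_ *: _ + _).
rewrite -mpolyXD !pihomogX /= mdegD mdeg1 add1n eqSS.
by case: ifP; rewrite ?mulr0 ?mpolyXD.
Qed.

Lemma pihomogXM0 k (h : S) : ('X_k * h)^_(0%N) = 0.
Proof.
elim/mpolyind: h => [|a m p _ _ IHp]; first by rewrite mulr0 !linear0.
rewrite mulrDr -scalerAr linearP /= IHp addr0 -mpolyXD pihomogX /=.
by rewrite mdegD mdeg1 scaler0.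
Qed.

Hypothesis infinite_fibre : forall h : C -> nat,
  exists d, forall N, exists s : seq C,
    [/\ uniq s, size s = N & {in s, forall c, h c = d}].

(* A common zero of J and 'X_k - 1, where 'X_k is not in J. *)
Lemma relevant_prime_zero (J : S -> Prop) : relevant_prime J ->
  exists2 c : 'I_n -> C, (exists i, c i != 0) &
    forall H, J H -> line_restriction c H = 0.
Proof.
move=> J_prime; have J_ideal := rprime_ideal J_prime.
have [k J'Xk] := rprime_relevant J_prime.
have not1 : ~ adjoin J ('X_k - 1%:MP) 1.
  move=> [g [h [Jg eq1]]].
  (* Comparing components in 1 = g + (X_k - 1) h gives h_0 = -1 and h_(e+1) = X_k h_e modulo J,
     hence h_e = -X_k^e. Past the degree of h this puts a power of X_k in J. *)
  have Jh e : J (h^_(e) + 'X_k ^+ e).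
    elim: e => [|e IHe].
      have := congr1 (pihomog mdeg 0) eq1.
      rewrite linearD mulrBl linearB /= pihomogXM0 mul1r sub0r.
      rewrite (pihomog_dE (dhomog1 _ _)) => eq1'.
      rewrite expr0 eq1' addrCA subrr addr0; exact: rprime_homog.
    have := congr1 (pihomog mdeg e.+1) eq1.
    rewrite linearD mulrBl linearB /= pihomogXM mul1r.
    rewrite (pihomog_ne0 _ (dhomog1 _ _)) // => eq1'.
    have -> : h^_(e.+1) + 'X_k ^+ e.+1 = g^_(e.+1) + 'X_k * (h^_(e) + 'X_k ^+ e).
      rewrite mulrDr -exprS addrA; congr (_ + _); apply/eqP.
      by rewrite eq_sym -subr_eq0 -addrA -eq1'.
    apply: (idealD J_ideal); first exact: rprime_homog.
    exact: idealM.
  case: J'Xk; apply: (rprime_exp (k := msize h) J_prime).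
  have := Jh (msize h); rewrite [X in X + _](_ : _ = 0) ?add0r //.
  apply/mpolyP => m; rewrite mcoeff0 pihomogE raddf_sum big_seq_cond big1 //= => m'.
  move=> /andP[m'h /eqP dm']; have := msize_mdeg_lt m'h.
  by rewrite dm' ltnn.
have [|v vJ] := weak_nullstellensatz infinite_fibre (J := adjoin J ('X_k - 1%:MP)).
  exact: adjoin_ideal.
exists v.
  exists k; suff : ('X_k - 1%:MP : S).@[v] = 0.
    by rewrite mevalB mevalXU mevalC => /eqP; rewrite subr_eq0 => /eqP ->; apply: oner_neq0.
  by apply: vJ; exists 0, 1; split; [exact: ideal0 | ring].
move=> H JH; apply/line_restriction_eq0 => d; apply: vJ.
by exists H^_(d), 0; split; [exact: rprime_homog | ring].
Qed.

End GradedPrimes.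

(** * The isomorphism *)

Section FormSpaceIsomorphism.
Variables (C : closedFieldType) (S1 S2 : comAlgType C).
Variables (gr1 : nat -> set S1) (gr2 : nat -> set S2).
Variables (T1 T2 : Type) (van1 : T1 -> set S1) (van2 : T2 -> set S2).
Variables (phi : {linear S1 -> S2}) (F : T1 -> T2).
Hypothesis gr1_lin : forall d c f g, gr1 d f -> gr1 d g -> gr1 d (f - c *: g).
Hypothesis phi_gr : forall d f, gr1 d f -> gr2 d (phi f).
Hypothesis phi_surj : forall d g, gr2 d g -> exists2 f, gr1 d f & phi f = g.
Hypothesis F_bij : bijective F.
Hypothesis van_phi : forall p d f, gr1 d f -> (van1 p f <-> van2 (F p) (phi f)).

Lemma form_zclosed_preimage (Z : set T2) :
  form_zclosed gr2 van2 Z <-> form_zclosed gr1 van1 (F @^-1` Z).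
Proof.
split=> [[E Ehom ZE]|[E Ehom ZE]].
  (* Only homogeneous preimages are kept, since vanishing is compared on forms alone. *)
  exists [set f | (exists d, gr1 d f) /\ E (phi f)] => [f []//|].
  rewrite ZE; apply/predeqP => p; split=> /= [Ep f [[d df] Ef]|Ep g Eg].
    by apply/(van_phi _ df)/Ep.
  have [d /phi_surj[f df fg]] := Ehom _ Eg; rewrite -fg.
  by apply/(van_phi _ df)/Ep; split; [exists d | rewrite /= fg].
have [G FK GK] := F_bij.
exists [set g | exists2 f, E f & phi f = g] => [g [f /Ehom[d df] <-]|].
  by exists d; apply: phi_gr.
apply/predeqP => q; rewrite -[q]GK.
have -> : Z (F (G q)) = (F @^-1` Z) (G q) by [].
rewrite ZE; split=> /= [Ep g [f Ef <-]|Ep f Ef]; have [d df] := Ehom _ Ef.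
  by apply/(van_phi _ df)/Ep.
by apply/(van_phi _ df)/Ep; exists f.
Qed.

Lemma form_regular_preimage (U : set T2) (a : T2 -> C) :
  form_regular gr2 van2 U a <-> form_regular gr1 van1 (F @^-1` U) (a \o F).
Proof.
have [G FK GK] := F_bij.
split=> [reg p Up|reg q Uq].
  have [W [Wopen Wp WU [d [f [g [df dg fg]]]]]] := reg _ Up.
  have [f' df' f'f] := phi_surj df; have [g' dg' g'g] := phi_surj dg.
  exists (F @^-1` W); split=> // [|p' /WU //|].
    exact/(form_zclosed_preimage (~` W)).
  exists d, f', g'; split=> // p' Wp'; have [ng fag] := fg _ Wp'; split.
    by move/(van_phi _ dg'); rewrite g'g.
  by apply/(van_phi _ (gr1_lin _ df' dg')); rewrite linearB linearZ /= f'f g'g.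
have [|W [Wopen Wp WU [d [f [g [df dg fg]]]]]] := reg (G q); first by rewrite /= GK.
have FGW : F @^-1` (G @^-1` W) = W by apply/predeqP => p; rewrite /= FK.
exists (G @^-1` W); split=> // [|q' /WU /=|].
- by apply/form_zclosed_preimage; rewrite -preimage_setC FGW.
- by rewrite GK.
exists d, (phi f), (phi g); split=> [||q' Wq']; try exact: phi_gr.
have [ng fag] := fg _ Wq'; rewrite -[q']GK; split.
  by move/(van_phi _ dg).
by rewrite -linearZ -linearB; apply/(van_phi _ (gr1_lin _ df dg)).
Qed.

Lemma form_space_isomorphic :
  isomorphic (form_space gr1 van1) (form_space gr2 van2).
Proof.
exists F; split=> // [Z|U a _]; first exact: form_zclosed_preimage.
exact: form_regular_preimage.
Qed.

End FormSpaceIsomorphism.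

(** * Closed points of Proj and points of the cone *)

Section ClosedPoints.
Variables (C : numClosedFieldType) (l : nat).
Hypothesis l_gt0 : (0 < l)%N.
Hypothesis infinite_fibre : forall h : C -> nat,
  exists d, forall N, exists s : seq C,
    [/\ uniq s, size s = N & {in s, forall c, h c = d}].
Local Notation n := (2 * l)%N.
Local Notation S := {mpoly C[2 * n]}.
Local Notation V := (gr_sections C 2 l).
Local Notation N := (\dim V).
Local Notation Y := {mpoly C[N]}.
Local Notation gr := (@SL2_invariants C n).
Local Notation segre_param := (comp_mpoly (seg_coords C l)).

Lemma graded_sum_segre_param (f : S) :
  graded_sum gr f <-> exists H : Y, segre_param H = f.
Proof.
split=> [[m [h [h_gr ->]]]|[H <-]].
  have [H HP] := choice (fun d => let: ex_intro2 H Hd Hh :=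
    segre_param_surj (h_gr d) in ex_intro (fun H => segre_param H = h d) H Hh).
  exists (\sum_(d < m) H d); rewrite linear_sum.
  by apply: eq_bigr => d _; apply: HP.
exists (msize H), (fun d => segre_param (pihomog mdeg d H)); split=> [d|].
  exact/segre_param_invariant/pihomogP.
by rewrite -linear_sum -pihomog_partitionE.
Qed.

(** For relevance: if all variables were in the pullback, so would be every form of positive degree,
    and P would contain all invariants of positive degree. *)
Lemma homogeneous_prime_pullback (P : set S) : homogeneous_prime gr P ->
  relevant_prime (fun H : Y => P (segre_param H)).
Proof.
move=> P_prime.
have in_gr (H : Y) : graded_sum gr (segre_param H).
  by apply/graded_sum_segre_param; exists H.
have P_ideal : proper_ideal (fun H : Y => P (segre_param H)).
  split=> [|f g Pf Pg|f g Pg|].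
  - by rewrite linear0; apply: hprime0 P_prime.
  - by rewrite linearD; apply: (hprimeD P_prime) Pf Pg.
  - by rewrite rmorphM; apply: (hprimeM P_prime) (in_gr f) Pg.
  - by rewrite rmorph1; exact: (hprime_proper P_prime).
split=> // [f g|f d Pf|].
- by rewrite rmorphM; apply: (hprime_prime P_prime) (in_gr f) (in_gr g).
- apply: (hprime_homog P_prime (n := maxn (msize f) d.+1)
    (h := fun e => segre_param (pihomog mdeg e f))) => [e||].
  + exact/segre_param_invariant/pihomogP.
  + by rewrite -linear_sum -pihomog_partitionE // leq_maxl.
  + by rewrite leq_maxr.
have [d [f [d_gt0 /segre_param_surj[H H_homog <-] nPf]]] := hprime_relevant P_prime.
apply/not_existsP => PX; apply: nPf.
apply: (ideal_mnm_factor P_ideal _ d_gt0 H_homog) => i.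
by have /contrapT := PX i.
Qed.

Definition param_image (J : Y -> Prop) : set S :=
  [set f | exists2 H, J H & segre_param H = f].

(** As [J] contains the kernel, membership does not depend on the preimage. *)
Lemma param_imageE (J : Y -> Prop) H : proper_ideal J ->
  (forall H, segre_param H = 0 -> J H) -> param_image J (segre_param H) <-> J H.
Proof.
move=> J_ideal kerJ; split=> [[H' JH' HH']|JH]; last by exists H.
rewrite -(subrK H' H); apply: idealD => //; apply: kerJ.
by rewrite linearB /= HH' subrr.
Qed.

Lemma homogeneous_prime_image (J : Y -> Prop) : relevant_prime J ->
  (forall H, segre_param H = 0 -> J H) -> homogeneous_prime gr (param_image J).
Proof.
move=> J_prime kerJ; have J_ideal := rprime_ideal J_prime.
have JE H := @param_imageE J H J_ideal kerJ.
split.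
- by move=> f [H _ <-]; apply/graded_sum_segre_param; exists H.
- by exists 0; [exact: ideal0 | rewrite linear0].
- move=> f g [H JH <-] [H' JH' <-]; exists (H + H'); first exact: idealD.
  by rewrite linearD.
- move=> f g /graded_sum_segre_param[H <-] [H' JH' <-].
  by exists (H * H'); [exact: idealM | rewrite rmorphM].
- move=> m h h_gr P_sum d dm.
  have [H HP] := choice (fun d => let: ex_intro2 H Hd Hh :=
    segre_param_surj (h_gr d) in
    ex_intro (fun H => H \is d.-homog /\ segre_param H = h d) H (conj Hd Hh)).
  have JH : J (\sum_(e < m) H e).
    apply/JE; rewrite linear_sum (eq_bigr (fun e : 'I_m => h e)) // => e _.
    by have [] := HP e.
  exists (H d); last by have [] := HP d.
  have := rprime_homog J_prime d JH; rewrite linear_sum (bigD1 (Ordinal dm)) //=.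
  rewrite pihomog_dE; last by have [] := HP d.
  rewrite big1 ?addr0 // => e ed; have [He _] := HP e.
  by rewrite (pihomog_ne0 _ He) //; apply: contra ed => /eqP ed; apply/eqP/val_inj.
- by rewrite -[1](rmorph1 segre_param) JE; exact: (ideal_proper J_ideal).
- move=> f g /graded_sum_segre_param[H <-] /graded_sum_segre_param[H' <-].
  rewrite -rmorphM => /JE /(rprime_prime J_prime)[JH|JH'].
    by left; apply/JE.
  by right; apply/JE.
- have [i nJX] := rprime_relevant J_prime.
  exists 1%N, (segre_param 'X_i); split=> //.
    by apply: segre_param_invariant; rewrite dhomogX /= mdeg1.
  by rewrite JE.
Qed.

(* c lies on the affine cone over the closure of the image of the Segre map. *)
Definition on_cone (c : 'I_N -> C) : Prop :=
  forall d H, H \is d.-homog -> segre_param H = 0 -> H.@[c] = 0.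

Definition cone_prime (c : 'I_N -> C) : set S :=
  param_image (fun H => line_restriction c H = 0).

Lemma on_cone_ker c H : on_cone c -> segre_param H = 0 -> line_restriction c H = 0.
Proof.
move=> c_cone H0; apply/line_restriction_eq0 => d.
apply: c_cone (pihomogP _ _ _) _; exact: segre_param_ker.
Qed.

Lemma cone_primeE c d H : (exists i, c i != 0) -> on_cone c -> H \is d.-homog ->
  cone_prime c (segre_param H) <-> H.@[c] = 0.
Proof.
move=> c0 c_cone H_homog; rewrite /cone_prime param_imageE.
- exact: (line_restriction_homog _ H_homog).
- exact: rprime_ideal (line_restriction_prime c0).
- by move=> H'; apply: on_cone_ker.
Qed.

(** Maximality is checked after pulling back to C[y], where the prime of c is maximal among relevant
    primes. *)
Lemma cone_prime_closed_point c : (exists i, c i != 0) -> on_cone c ->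
  closed_point gr (cone_prime c).
Proof.
move=> c0 c_cone; split.
  apply: homogeneous_prime_image; first exact: line_restriction_prime.
  by move=> H; apply: on_cone_ker.
move=> Q Q_prime PQ f Qf.
have /graded_sum_segre_param[H fH] := hprime_sub Q_prime Qf.
exists H => //; apply: (line_restriction_maximal c0
  (homogeneous_prime_pullback Q_prime)) => [H' H'0|]; last by rewrite fH.
by apply: PQ; exists H'.
Qed.

(** A zero c of the pullback of P gives an inclusion of P in the prime of c, and maximality of P
    makes it an equality; c is on the cone because the pullback contains the kernel. *)
Lemma closed_point_cone_prime (P : set S) : closed_point gr P ->
  exists2 c, (exists i, c i != 0) & on_cone c /\ P = cone_prime c.
Proof.
move=> [P_prime P_max]; have J_prime := homogeneous_prime_pullback P_prime.
have [c c0 cJ] := relevant_prime_zero infinite_fibre J_prime.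
have c_cone : on_cone c.
  move=> d H H_homog H0; apply/(line_restriction_homog _ H_homog)/cJ.
  by rewrite H0; apply: hprime0 P_prime.
exists c => //; split=> //.
have [c_prime _] := cone_prime_closed_point c0 c_cone.
have Pc : P `<=` cone_prime c.
  move=> f Pf; have /graded_sum_segre_param[H fH] := hprime_sub P_prime Pf.
  by exists H => //; apply: cJ; rewrite fH.
by apply/seteqP; split=> //; apply: P_max.
Qed.

End ClosedPoints.

(** * Lines and homogeneous coordinates *)

Section ProjectivePoints.
Variables (C : closedFieldType) (W : vectType C) (V : {vspace W}).
Local Notation coords v := (fun i => coord (vbasis V) i v).

Lemma proj_pointE (L : proj_point V) :
  [/\ sval L = <[vpick (sval L)]>%VS, vpick (sval L) \in V & vpick (sval L) != 0].
Proof.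
case: L => L /= /andP[LV /eqP dimL].
have v0 : vpick L != 0 by rewrite vpick0 -dimv_eq0 dimL.
split=> //; last exact: subvP LV _ (memv_pick L).
by apply/esym/eqP; rewrite eqEdim -memvE memv_pick dim_vline v0 dimL.
Qed.

Lemma coords_neq0 v : v \in V -> v != 0 -> exists i, coord (vbasis V) i v != 0.
Proof.
move=> vV v0; apply/existsP; apply: contraNT v0 => /existsPn coord0.
rewrite (coord_vbasis vV) big1 // => i _.
by have /negPn/eqP -> := coord0 i; rewrite scale0r.
Qed.

Lemma meval_homog n d (f : {mpoly C[n]}) a (c : 'I_n -> C) :
  f \is d.-homog -> f.@[fun i => a * c i] = a ^+ d * f.@[c].
Proof.
move=> /dhomogP f_homog; rewrite !mevalE mulr_sumr big_seq [RHS]big_seq.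
apply: eq_bigr => m mf; rewrite -(f_homog _ mf) /= mdegE -prodrXr mulrCA -big_split.
by congr (_ * _); apply: eq_bigr => i _; rewrite exprMn.
Qed.

Lemma proj_van_line (L : proj_point V) v d f : sval L = <[v]>%VS ->
  f \is d.-homog -> proj_van L f <-> f.@[coords v] = 0.
Proof.
move=> L_v f_homog; split=> [->//|fv w]; first by rewrite L_v memv_line.
rewrite L_v => /vlineP[a ->].
rewrite (meval_eq _ (_ : _ =1 (fun i => a * coord (vbasis V) i v))).
  by rewrite (meval_homog _ _ f_homog) fv mulr0.
by move=> i; rewrite linearZ.
Qed.

Lemma proj_point_line v : v \in V -> v != 0 ->
  exists L : proj_point V, sval L = <[v]>%VS.
Proof.
move=> vV v0.
have Lv : (<[v]> <= V)%VS && (\dim <[v]> == 1%N) by rewrite -memvE vV dim_vline v0.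
by exists (exist _ <[v]>%VS Lv).
Qed.

End ProjectivePoints.

Lemma max_minor_bracket (C : numClosedFieldType) n (A : 'M[C]_(2, n)) f :
  max_minor A f = (bracket C (val f 0) (val f 1)).@[mxvec A ord0].
Proof.
rewrite /max_minor (expand_det_row _ 0) big_ord2 /cofactor !det_mx11 !mxE.
rewrite mevalB !mevalM !mevalXU !mxvecE /= expr0 mul1r expr1 mulN1r mulrN.
have lift00 : lift (0 : 'I_2) (0 : 'I_1) = 1 by apply: val_inj.
have lift10 : lift (1 : 'I_2) (0 : 'I_1) = 0 by apply: val_inj.
by rewrite lift00 lift10; congr (_ - _); rewrite mulrC.
Qed.

Lemma max_minor_neq0 (C : numClosedFieldType) n (A : 'M[C]_(2, n)) :
  (forall f : plucker_index 2 n, max_minor A f != 0) <->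
  (forall i j : 'I_n, i != j -> (bracket C i j).@[mxvec A ord0] != 0).
Proof.
split=> [minors|brackets f]; last first.
  rewrite max_minor_bracket; apply: brackets.
  by rewrite (inj_eq (@plucker_index_inj _ _ f)).
have lt_bracket (i j : 'I_n) : (i < j)%N -> (bracket C i j).@[mxvec A ord0] != 0.
  move=> ij; pose f : {ffun 'I_2 -> 'I_n} := [ffun a => if a == 0 then i else j].
  have f_incr : [forall a : 'I_2, forall b : 'I_2, (a < b)%N ==> (f a < f b)%N].
    apply/forallP => a; apply/forallP => b; apply/implyP.
    by have [->|->] := ord2_eq a; have [->|->] := ord2_eq b; rewrite !ffunE.
  by have := minors (exist _ f f_incr); rewrite max_minor_bracket /= !ffunE.
move=> i j ij; have [/lt_bracket //|/lt_bracket|/val_inj ij'] := ltngtP i j.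
  by rewrite bracketC mevalN oppr_eq0.
by rewrite ij' eqxx in ij.
Qed.

Lemma bracket_neq0 (C : numFieldType) n (i j : 'I_n) :
  i != j -> bracket C i j != 0.
Proof.
(* The derivative in the first coordinate of column i is a variable, hence nonzero. *)
move=> ij; apply: contraTneq isT => /(congr1 (coord_deriv 0 i)).
rewrite coord_deriv0 /bracket coord_derivB !coord_derivM !coord_deriv_var !eqxx.
rewrite (negPf ij) /= mul1r mulr0 mul0r mulr0 !addr0 subr0.
by move/eqP; rewrite -msupp_eq0 msuppX.
Qed.

(** * The closure of the Segre image and the bijection of points *)

Section SegreClosure.
Variables (C : numClosedFieldType) (l : nat).
Hypothesis l_gt0 : (0 < l)%N.
Hypothesis infinite_fibre : forall h : C -> nat,
  exists d, forall N, exists s : seq C,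
    [/\ uniq s, size s = N & {in s, forall c, h c = d}].
Local Notation n := (2 * l)%N.
Local Notation S := {mpoly C[2 * n]}.
Local Notation V := (gr_sections C 2 l).
Local Notation N := (\dim V).
Local Notation Y := {mpoly C[N]}.
Local Notation segre_param := (comp_mpoly (seg_coords C l)).
Local Notation coords v := (fun i => coord (vbasis V) i v).

Let segre_closure := @zclosure _ (proj_space V) (@segre_image C 2 l).

Lemma segre_param_coefs (A : 'M[C]_(2, n)) (H : Y) :
  (segre_param H).@[mxvec A ord0] =
  H.@[coords (coefs (Seg (map_mx (fun a => a%:MP) A) (generic_mx C 2 l)))].
Proof.
by rewrite segre_param_eval; apply: meval_eq => i; rewrite seg_coord_eval.
Qed.

(** The bracket product of a perfect matching is a linear form in these coefficients, and it is
    nonzero at [A]. *)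
Lemma coefs_seg_neq0 (A : 'M[C]_(2, n)) :
    (forall f : plucker_index 2 n, max_minor A f != 0) ->
  coefs (Seg (map_mx (fun a => a%:MP) A) (generic_mx C 2 l)) != 0.
Proof.
move=> /max_minor_neq0 brackets.
have [H H_homog H_matching] := segre_param_matching C (@half_matching_perfect l).
have : (bracket_monomial C (half_matching l)).@[mxvec A ord0] != 0.
  rewrite rmorph_prod prodf_seq_neq0; apply/allP => e /mapP[r _ ->] /=.
  by apply: brackets; rewrite (inj_eq (@half_row_inj l)) eq_lrshift.
apply: contraNneq => coefs0; rewrite -H_matching segre_param_coefs coefs0.
(* Zero is written 0 * 0 so that homogeneity applies with the scalar 0. *)
rewrite (meval_eq _ (_ : _ =1 (fun=> 0 * 0))); last by move=> i; rewrite linear0 mul0r.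
by rewrite (meval_homog _ _ H_homog) expr1 mul0r.
Qed.

(** A form vanishes on the image exactly when its pullback is zero: the pullback vanishes wherever
    no bracket does, so its product with all brackets is the zero function. *)
Lemma segre_closureE (L : proj_point V) : segre_closure L <->
  forall d H, H \is d.-homog -> segre_param H = 0 -> proj_van L H.
Proof.
split=> [L_cl d H H_homog H0|L_van Z [E E_homog ->] image_E H EH].
  pose E : set Y := [set H | (exists d, H \is d.-homog) /\ segre_param H = 0].
  apply: (L_cl [set L | E `<=` proj_van L]) => [|L' [A _ L'A] H' [[e H'e] H'0]|].
  - by exists E => // H' [[e He] _]; exists e.
  - by apply/(proj_van_line L'A H'e); rewrite -segre_param_coefs H'0 meval0.
  - by split; [exists d|].
have [d H_homog] := E_homog _ EH; apply: (L_van d) => //.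
pose bad : S := \prod_(p : 'I_n * 'I_n | p.1 != p.2) bracket C p.1 p.2.
have bad_neq0 : bad != 0 by apply/prodf_neq0 => p; apply: bracket_neq0.
suff /eqP : segre_param H * bad = 0.
  by rewrite mulf_eq0 (negPf bad_neq0) orbF => /eqP.
apply: mpoly_eq0_meval => v; pose A : 'M[C]_(2, n) := vec_mx (\row_k v k).
have -> : (segre_param H * bad).@[v] = (segre_param H * bad).@[mxvec A ord0].
  by apply: meval_eq => k; rewrite vec_mxK mxE.
rewrite mevalM; have [->|badA] := eqVneq bad.@[mxvec A ord0] 0.
  by rewrite mulr0.
have minors : forall f : plucker_index 2 n, max_minor A f != 0.
  apply/max_minor_neq0 => i j ij; apply: contraNneq badA => ij0.
  by rewrite /bad rmorph_prod (bigD1 (i, j)) //= ij0 mul0r.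
have [L' L'A] := proj_point_line (coefs_seg_mem A) (coefs_seg_neq0 minors).
have /image_E : segre_image L' by exists A.
move=> /(_ _ EH)/(proj_van_line L'A H_homog); rewrite -segre_param_coefs => ->.
by rewrite mul0r.
Qed.

Let base (L : proj_point V) : 'I_N -> C := coords (vpick (sval L)).

Lemma base_neq0 L : exists i, base L i != 0.
Proof. by have [_ vV v0] := proj_pointE L; apply: coords_neq0. Qed.

Lemma base_van L d H : H \is d.-homog -> proj_van L H <-> H.@[base L] = 0.
Proof. by have [L_v _ _] := proj_pointE L; apply: proj_van_line. Qed.

Lemma base_on_cone L : segre_closure L <-> on_cone (base L).
Proof.
rewrite segre_closureE; split=> L_van d H H_homog H0.
  exact/(base_van L H_homog)/(L_van d).
exact/(base_van L H_homog)/(L_van d).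
Qed.

Definition point_map (L : {L : proj_point V | segre_closure L}) :
    {P : set S | closed_point (@SL2_invariants C n) P} :=
  exist _ (cone_prime (base (sval L)))
    (cone_prime_closed_point l_gt0 (base_neq0 (sval L))
       ((base_on_cone (sval L)).1 (svalP L))).

Lemma point_map_van L d H : H \is d.-homog ->
  proj_van (sval L) H <-> sval (point_map L) (segre_param H).
Proof.
move=> H_homog; have L_cone := (base_on_cone (sval L)).1 (svalP L).
apply: iff_trans (base_van _ H_homog) (iff_sym _).
exact: (cone_primeE l_gt0 (base_neq0 (sval L)) L_cone H_homog).
Qed.

(** The linear forms c_k X_i - c_i X_k vanishing at [L] also vanish at [L'], so the coordinates are
    proportional. *)
Lemma point_map_inj : injective point_map.
Proof.
move=> L L' LL'; suff : sval L = sval L'.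
  by case: L L' {LL'} => L L_cl [L' L'_cl] /= LL'; apply: eq_exist.
apply: val_inj => /=.
have [L_v vV v0] := proj_pointE (sval L).
have [L'_v v'V v'0] := proj_pointE (sval L').
have [k ck] := base_neq0 (sval L).
have prop i : base (sval L) k * base (sval L') i = base (sval L) i * base (sval L') k.
  pose H : Y := base (sval L) k *: 'X_i - base (sval L) i *: 'X_k.
  have H_homog : H \is 1.-homog by rewrite rpredB // dhomogZ // dhomogX /= mdeg1.
  have : proj_van (sval L) H.
    apply/(base_van _ H_homog).
    by rewrite mevalB !mevalZ !mevalXU mulrC subrr.
  move/(point_map_van _ H_homog); rewrite LL' => /(point_map_van _ H_homog).
  move/(base_van _ H_homog); rewrite mevalB !mevalZ !mevalXU.
  by move/eqP; rewrite subr_eq0 => /eqP.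
rewrite [LHS]L_v [RHS]L'_v; apply/esym/eqP; rewrite eqEdim !dim_vline v0 v'0 andbT.
rewrite -memvE; apply/vlineP; exists (base (sval L') k / base (sval L) k).
rewrite (coord_vbasis vV) (coord_vbasis v'V) scaler_sumr.
apply: eq_bigr => i _; rewrite scalerA; congr (_ *: _).
by apply: (mulfI ck); rewrite prop; field.
Qed.

Lemma point_map_surj P : exists L, point_map L = P.
Proof.
case: P => P P_closed.
have [c [k ck] [c_cone Pc]] := closed_point_cone_prime l_gt0 infinite_fibre P_closed.
pose v := \sum_(i < N) c i *: (vbasis V)`_i.
have coord_v i : coord (vbasis V) i v = c i.
  exact: coord_sum_free (basis_free (vbasisP V)).
have vV : v \in V.
  by apply: rpred_sum => i _; apply/memvZ/vbasis_mem/mem_nth; rewrite size_tuple.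
have v0 : v != 0 by apply: contraNneq ck => v0; rewrite -coord_v v0 linear0.
have [L L_v] := proj_point_line vV v0.
have van_c d (H : Y) : H \is d.-homog -> proj_van L H <-> H.@[c] = 0.
  by move=> H_homog; rewrite (proj_van_line L_v H_homog) (meval_eq _ coord_v).
have L_cl : segre_closure L.
  by apply/segre_closureE => d H H_homog H0; apply/(van_c _ _ H_homog)/(c_cone d).
exists (exist _ L L_cl); apply: eq_exist => /=; rewrite Pc.
(* The coordinates [base L] are only proportional to [c], but vanishing of each homogeneous
   component depends on the line alone. *)
apply/predeqP => f; split=> -[H H0 <-]; exists H => //; apply/line_restriction_eq0 => d;
have Hd := pihomogP mdeg d H; have /line_restriction_eq0/(_ d) := H0.
  by move/(base_van _ Hd)/(van_c _ _ Hd).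
by move/(van_c _ _ Hd)/(base_van _ Hd).
Qed.

Theorem Coeff_Seg_isomorphic : isomorphic (Coeff_Seg C 2 l) (GIT_P1 C (2 * l)).
Proof.
apply: (@form_space_isomorphic _ _ _ _ _ _ _ _ _ segre_param point_map).
- by move=> d a f g; rewrite /proj_form /= => df dg; rewrite rpredB // dhomogZ.
- exact: segre_param_invariant.
- exact: segre_param_surj.
- have [g gK] := choice point_map_surj; exists g => // L.
  by apply: point_map_inj; rewrite gK.
- exact: point_map_van.
Qed.

End SegreClosure.

Theorem corollary6p3 (R : realType) (l : nat) (l_gt0 : (0 < l)%N) :
  isomorphic (Coeff_Seg R[i] 2 l) (GIT_P1 R[i] (2 * l)).
Proof. exact: Coeff_Seg_isomorphic l_gt0 (@infinite_fibre_complex R). Qed.
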